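(* There exists an absolute constant $s_0$ such that for all positive integers $n,k,s$ with $s\ge s_0$ and $n\ge \frac53 sk-\frac23 s$ one has $$m(n,k,s)=\binom nk-\binom{n-s}k .$$
   Context: $[n]=\{1,\dots,n\}$ and $\binom{[n]}k$ is the family of all $k$-element subsets of $[n]$. For $\mathcal F\subset\binom{[n]}k$, a matching in $\mathcal F$ is a collection of pairwise disjoint members of $\mathcal F$, and $\nu(\mathcal F)$ is the maximum size of a matching in $\mathcal F$. $m(n,k,s)$ is the maximum of $|\mathcal F|$ over all $\mathcal F\subset\binom{[n]}k$ with $\nu(\mathcal F)<s+1$. *)

(* Defs.v *)
(* The ground set {1, ..., n} is represented by 'I_n. *)
From mathcomp Require Import all_boot all_order all_algebra.

Set Implicit Arguments.
Unset Strict Implicit.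
Unset Printing Implicit Defensive.

Definition ksubsets (n k : nat) : {set {set 'I_n}} := [set A : {set 'I_n} | #|A| == k].

Definition is_matching (n : nat) (F M : {set {set 'I_n}}) : bool :=
  (M \subset F) && trivIset M.

Definition matching_number (n : nat) (F : {set {set 'I_n}}) : nat :=
  \max_(M : {set {set 'I_n}} | is_matching F M) #|M|.

(* The range of the maximum is never empty, as F = set0 always qualifies. *)
Definition max_family_size (n k s : nat) : nat :=
  \max_(F : {set {set 'I_n}}
       | (F \subset ksubsets n k) && (matching_number F < s.+1)) #|F|.

(* Main.v *)
(* Induction on k. By shifting, F may be assumed shifted. Write n = s + 1 + N, k = l + 1, and
   split F according to the trace of its members on the first s + 1 points: F_0, ..., F_s are
   the l-uniform families of traces {i}, they are nested and cross-dependent, and H is the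
   k-uniform family of the members missing the first s + 1 points; the shadow of H lies in F_s.
   The members with at least two points there are bounded trivially, and what remains is
     |F_0| + ... + |F_(s-1)| + |F_s| + |H| <= s C(N, l).                                   (1)

   Place t = 5s/3 - O(1) disjoint l-sets in [N] at random. The number e of them in F_s has mean
   mu = t |F_s| / C(N, l) and E e^2 <= mu^2 + 2 mu, because the nontrivial eigenvalues of the
   Kneser graph are at most l / (N - l) times its degree. Cross-dependence gives an integer v
   in [e, s] such that at most (s - v) t + v^2 incidences occur between the t sets and
   F_0, ..., F_(s-1), which bounds the first sum in (1) in terms of mu.

   For H, Frankl's inequality |H| <= s |F_s| suffices when mu <= 5s/8. Otherwise one needs
   |H| <= 0.386 s C(N, l). In a shifted family without s + 1 disjoint members, every member A
   satisfies |A n [i(s+1) - 1]| >= i for some i. If i is the last such index for members of F_s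
   then the shadow inequality gains a factor i / (i + 1), and the densities of the classes with
   a given i are controlled by their second and third moments, which together with the
   induction hypothesis for F_s yields the constant. *)

Require Import Defs.
From mathcomp Require Import all_boot all_order all_algebra.
From mathcomp Require Import all_fingroup.
From mathcomp Require Import zify ring lra.

Set Implicit Arguments.
Unset Strict Implicit.
Unset Printing Implicit Defensive.
Import Order.TTheory GRing.Theory Num.Theory.

(** * Shifting *)

(** A form free of the maximum in [matching_number]; [matching_numberP] links the two. *)
Definition no_matching (T : finType) (s : nat) (F : {set {set T}}) :=
  forall M : {set {set T}}, M \subset F -> trivIset M -> #|M| <= s.

Lemma tperm_imsetK (T : finType) (x y : T) : involutive (fun A : {set T} => tperm x y @: A).
Proof.
by move=> A; rewrite -imset_comp (eq_imset _ (tpermK x y)) imset_id.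
Qed.

Lemma mem_tperm_imset (T : finType) (x y z : T) (A : {set T}) : (z \in tperm x y @: A) = (tperm x y z \in A).
Proof. by rewrite -{1}(tpermK x y z) mem_imset //; apply: perm_inj. Qed.

Lemma tperm_imset_id (T : finType) (x y : T) (A : {set T}) : x \notin A -> y \notin A -> tperm x y @: A = A.
Proof.
move=> xA yA; apply/setP=> z; rewrite mem_tperm_imset.
by case: tpermP => [->|->|//]; rewrite (negbTE xA) (negbTE yA).
Qed.

Lemma tperm_imset_swap (T : finType) (x y : T) (A : {set T}) : y \in A -> x \notin A -> tperm x y @: A = x |: (A :\ y).
Proof.
move=> yA xA; apply/setP=> z; rewrite mem_tperm_imset !inE.
by case: tpermP => [->|->|/eqP zx /eqP zy]; rewrite ?eqxx ?yA //=;
   [rewrite (negbTE xA) orbF; apply/esym/negP=> /eqP E; rewrite -E yA in xA | rewrite (negbTE zx) zy].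
Qed.

Section Shift.
Variables (n : nat).
Implicit Types (F M : {set {set 'I_n}}) (A B C : {set 'I_n}).

Definition shifted F := forall (x y : 'I_n) A,
  x < y -> A \in F -> y \in A -> x \notin A -> tperm x y @: A \in F.

(** A set stays put when its image already lies in [F]; this makes the map injective on [F]. *)
Definition shift (x y : 'I_n) F A :=
  if [&& y \in A, x \notin A & tperm x y @: A \notin F] then tperm x y @: A else A.

Lemma shift_inj x y F : {in F &, injective (shift x y F)}.
Proof.
move=> A B FA FB; rewrite /shift.
case: ifP => [/and3P[_ _ nA]|_]; case: ifP => [/and3P[_ _ nB]|_] //.
- by move/(inv_inj (tperm_imsetK x y)).
- by move=> E; rewrite E FB in nA.
- by move=> E; rewrite -E FA in nB.
Qed.

(** If a matching [M] of the shifted family is not inside [F], its only member containing [x] is a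
    moved set [A']. Apply the transposition to all of [M]: [A'] returns to [F], a member containing
    [y] stayed put because its image was in [F], and the others are fixed. *)
Lemma shift_no_matching x y F s : x != y -> no_matching s F -> no_matching s (shift x y F @: F).
Proof.
move=> xy nu M MS tI.
have [MF|/subsetPn[A' MA' FA']] := boolP (M \subset F); first exact: nu.
have inS C : C \in M -> y \in C -> x \notin C -> C \in F /\ tperm x y @: C \in F.
  move=> /(subsetP MS) /imsetP[B FB]; rewrite /shift; case: ifP => [/and3P[yB xB _] ->|].
    by rewrite !mem_tperm_imset tpermR (negbTE xB).
  by move=> /negbT cB -> yB xB; move: cB; rewrite yB xB negbK.
have inS' C : C \in M -> x \notin C -> C \in F.
  move=> /(subsetP MS) /imsetP[B FB]; rewrite /shift; case: ifP => [/and3P[yB xB _] ->|_ -> //].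
  by rewrite mem_tperm_imset tpermL yB.
have [xA' [yA' tA']] : x \in A' /\ y \notin A' /\ tperm x y @: A' \in F.
  have /(subsetP MS) /imsetP[B FB] := MA'; rewrite /shift; case: ifP => [/and3P[yB xB _] E|_ E].
    by rewrite E tperm_imsetK !mem_tperm_imset tpermL tpermR.
  by rewrite E FB in FA'.
rewrite -(card_imset (mem M) (inv_inj (tperm_imsetK x y))); apply: nu.
  apply/subsetP=> _ /imsetP[C MC ->].
  have [->//|CA'] := eqVneq C A'.
  have xC : x \notin C.
    have /trivIsetP/(_ C A' MC MA' CA') := tI.
    by rewrite disjoint_sym => /disjointFr ->.
  have [yC|yC] := boolP (y \in C); first by case: (inS C MC yC xC).
  by rewrite tperm_imset_id // inS'.
by rewrite imset_trivIset //; apply: perm_inj.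
Qed.
End Shift.

Section Shifted.
Variables (n : nat).
Implicit Types (F M : {set {set 'I_n}}) (A B C : {set 'I_n}).

Definition weight F := \sum_(A in F) \sum_(x in A) (x : nat).

Lemma sum_tperm_imset (x y : 'I_n) A : x < y -> y \in A -> x \notin A ->
  \sum_(z in tperm x y @: A) (z : nat) < \sum_(z in A) (z : nat).
Proof.
move=> xy yA xA; rewrite big_imset /=; last by move=> ? ? _ _; apply: perm_inj.
rewrite (bigD1 y) //= [ltnRHS](bigD1 y) //= tpermR.
rewrite (eq_bigr (fun z : 'I_n => z : nat)) ?ltn_add2r // => z /andP[zA zy].
by rewrite tpermD //; [apply: contraNneq xA => -> | rewrite eq_sym].
Qed.

Lemma shiftedP F : reflect (shifted F)
  [forall x : 'I_n, forall y : 'I_n, forall A : {set 'I_n},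
     [&& x < y, A \in F, y \in A & x \notin A] ==> (tperm x y @: A \in F)].
Proof.
apply: (iffP idP) => [/forallP H x y A xy FA yA xA|H].
  by move: (H x) => /forallP/(_ y)/forallP/(_ A)/implyP; rewrite xy FA yA xA; apply.
apply/forallP=> x; apply/forallP=> y; apply/forallP=> A; apply/implyP=> /and4P[? ? ? ?].
exact: H.
Qed.

Lemma shift_uniform k x y F : F \subset ksubsets n k -> shift x y F @: F \subset ksubsets n k.
Proof.
move=> /subsetP Fk; apply/subsetP=> _ /imsetP[A FA ->]; have := Fk A FA; rewrite !inE /shift.
by case: ifP => // _; rewrite card_imset //; apply: perm_inj.
Qed.

(** Every effective shift lowers [weight], so repeated shifting terminates. *)
Lemma exists_shifted k s F : F \subset ksubsets n k -> no_matching s F ->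
  exists F', [/\ F' \subset ksubsets n k, no_matching s F', #|F'| = #|F| & shifted F'].
Proof.
have [m] := ubnP (weight F); elim: m F => // m IH F; rewrite ltnS => wF Fk nu.
have [/shiftedP|] := boolP [forall x : 'I_n, forall y : 'I_n, forall A : {set 'I_n},
     [&& x < y, A \in F, y \in A & x \notin A] ==> (tperm x y @: A \in F)].
  by exists F.
case/forallPn=> x /forallPn[y] /forallPn[A]; rewrite negb_imply => /andP[/and4P[xy FA yA xA] nA].
have xy' : x != y by rewrite neq_ltn xy.
have [|||F' [? ? E ?]] := IH (shift x y F @: F).
- apply: leq_trans wF; rewrite /weight big_imset /=; last exact: shift_inj.
  rewrite (bigD1 A) //= [ltnRHS](bigD1 A) //= -addSn leq_add //.
    by rewrite /shift yA xA nA /=; apply: sum_tperm_imset.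
  apply: leq_sum => B _; rewrite /shift; case: ifP => // /and3P[? ? _].
  by apply: ltnW; apply: sum_tperm_imset.
- exact: shift_uniform.
- exact: shift_no_matching.
by exists F'; split=> //; rewrite E card_in_imset //; apply: shift_inj.
Qed.

Definition below (m : nat) : {set 'I_n} := [set x : 'I_n | x < m].

Lemma belowS m1 m2 : m1 <= m2 -> below m1 \subset below m2.
Proof. by move=> m12; apply/subsetP=> x; rewrite !inE => /leq_trans; apply. Qed.

(* The last hypothesis is the domination order on sets of a given size, expressed by counting
   elements in initial segments. *)
Lemma shifted_dominated F A C : shifted F -> A \in F -> #|C| = #|A| ->
  (forall m, #|A :&: below m| <= #|C :&: below m|) -> C \in F.
Proof.
move=> sF; have [d] := ubnP #|A :\: C|; elim: d A => // d IH A; rewrite ltnS => cd FA cC dom.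
have [/eqP|] := set_0Vmem (A :\: C).
  rewrite setD_eq0 => AC; suff -> : C = A by [].
  by apply/esym/eqP; rewrite eqEcard AC cC leqnn.
case=> y0 y0AC; case: (arg_minnP (fun z : 'I_n => z : nat) y0AC) => y yAC ymin {y0 y0AC}.
have /setDP[yA yC] : y \in A :\: C := yAC.
(* Up to [y], [C] has at least as many elements as [A], and [y] itself is missing from [C]. *)
have [x [xC xA xy]] : exists x, [/\ x \in C, x \notin A & x < y].
  have : ~~ (C :&: below y.+1 \subset A :&: below y.+1 :\ y).
    apply/negP => /subset_leq_card; apply/negP; rewrite -ltnNge; apply: leq_trans (dom y.+1).
    by rewrite [ltnRHS](cardsD1 y) !inE yA ltnSn.
  case/subsetPn=> x; rewrite !inE ltnS => /andP[xC xy]; rewrite xy andbT negb_and negbK.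
  case/orP=> [/eqP E|xA]; first by rewrite -E xC in yC.
  exists x; split=> //; rewrite ltn_neqAle xy andbT.
  by apply: contraNneq yC => /val_inj <-.
have xy' : x != y by rewrite neq_ltn xy.
have E := tperm_imset_swap yA xA.
have ct : #|tperm x y @: A| = #|A| by rewrite card_imset //; apply: perm_inj.
apply: (IH (tperm x y @: A)).
- apply: leq_trans cd; apply: proper_card; apply/properP; split.
    apply/subsetP=> z; rewrite E !inE => /andP[zC /orP[/eqP Ez|/andP[_ ->]]].
      by rewrite Ez xC in zC.
    by rewrite zC.
  by exists y => //; rewrite E !inE eqxx /= eq_sym (negbTE xy') andbF.
- exact: sF.
- by rewrite ct.
(* Beyond [y] the exchange of [y] for [x] does not raise the count. Up to [y], minimality of [y]
   puts [A :&: below m] inside [C]. *)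
move=> m; have [my|ym] := leqP m y; last first.
  apply: leq_trans (dom m).
  rewrite [leqRHS](cardsD1 y) !inE yA ym add1n.
  apply: leq_trans (_ : #|x |: ((A :&: below m) :\ y)| <= _).
    apply: subset_leq_card; apply/subsetP=> z; rewrite E !inE.
    by case: (z == x) => //= /andP[/andP[-> ->] ->].
  by rewrite cardsU1 -add1n leq_add2r leq_b1.
have AC : A :&: below m \subset C.
  apply/subsetP=> z; rewrite !inE => /andP[zA zm]; apply: contraTT zm => zC.
  by rewrite -leqNgt; apply: (leq_trans my); apply: ymin; apply/setDP.
apply: subset_leq_card; apply/subsetP=> z; rewrite E !inE => /andP[/orP[/eqP ->|/andP[zy zA]] zm].
  by rewrite xC.
by rewrite zm andbT; apply: (subsetP AC); rewrite !inE zA.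
Qed.
End Shifted.

Lemma disjoint_images_no_matching (T I : finType) (s : nat) (F : {set {set T}}) (C : I -> {set T}) :
  no_matching s F -> (forall i, C i \in F) -> (forall i, C i != set0) ->
  (forall i j, i != j -> [disjoint C i & C j]) -> #|I| <= s.
Proof.
move=> nu CF C0 dC.
have Ci : injective C.
  move=> i j E; apply/eqP; apply: contraNT (C0 i) => /dC.
  by rewrite E -setI_eq0 setIid.
rewrite -(card_imset predT Ci); apply: nu.
  by apply/subsetP=> _ /imsetP[i _ ->].
apply/trivIsetP=> _ _ /imsetP[i _ ->] /imsetP[j _ ->] ij.
by apply: dC; apply: contraNneq ij => ->.
Qed.

(* If the i-th element of A were at least i(s+1) for all i, then A would dominate
   each of the s+1 disjoint sets {j, (s+1)+j, ..., (k-1)(s+1)+j}. *)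
Lemma shifted_crossing n k s (F : {set {set 'I_n}}) A :
  0 < k -> shifted F -> F \subset ksubsets n k -> no_matching s F -> A \in F ->
  exists2 i, 0 < i & i <= #|A :&: below n (i * s.+1 - 1)|.
Proof.
move=> k0 sF Fk nu FA.
have cA : #|A| = k by move: (subsetP Fk A FA); rewrite inE => /eqP.
have [/existsP[i]|] := boolP [exists i : 'I_k.+1, (0 < i) && (i <= #|A :&: below n (i * s.+1 - 1)|)].
  by case/andP; exists i.
rewrite negb_exists => /forallP H.
have {}H i : 0 < i <= k -> #|A :&: below n (i * s.+1 - 1)| < i.
  move=> /andP[i0 ik]; have ik' : i < k.+1 by [].
  by have := H (Ordinal ik'); rewrite /= i0 /= -ltnNge.
have hk : k * s.+1 <= n.
  have : ~~ (A \subset below n (k * s.+1 - 1)).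
    by apply/negP=> /setIidPl E; have := H k; rewrite E cA ltnn k0 leqnn => /(_ isT).
  by case/subsetPn=> x _; rewrite inE -leqNgt; have := ltn_ord x; lia.
have fP (j : 'I_s.+1) (i : 'I_k) : i * s.+1 + j < n.
  have := ltn_ord i; have := ltn_ord j; nia.
pose f j i := Ordinal (fP j i).
have fE j i j' i' : f j i = f j' i' -> i = i' /\ j = j'.
  move=> /(congr1 val) /= E; split; apply: val_inj => /=.
    by have := congr1 (divn^~ s.+1) E; rewrite /= !divnMDl // !divn_small // !addn0.
  by have := congr1 (modn^~ s.+1) E; rewrite /= !modnMDl !modn_small.
pose C j := [set f j i | i : 'I_k].
suff : #|'I_s.+1| <= s by rewrite card_ord ltnn.
apply: (disjoint_images_no_matching (C := C) nu).
- move=> j; apply: (shifted_dominated sF FA).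
    by rewrite card_imset ?card_ord // => i i' /fE[].
  move=> m; set r := #|A :&: below n m|.
  have rk : r <= k by rewrite -cA subset_leq_card // subsetIl.
  (* Having r > 0 elements of [A] below m forces m >= r (s + 1), so the first r elements of [C j]
     lie below m too. *)
  have hm : r * s.+1 <= m \/ r = 0.
    have [r0|r0] := posnP r; [by right|left].
    rewrite leqNgt; apply/negP => mr; have := H r; rewrite r0 rk => /(_ isT).
    rewrite ltnNge => /negP; apply; apply: subset_leq_card; apply: setIS.
    by apply: belowS; lia.
  rewrite -(card_ord r) -(card_imset _ (f := fun i : 'I_r => f j (widen_ord rk i))).
    apply: subset_leq_card; apply/subsetP=> _ /imsetP[i _ ->].
    rewrite !inE imset_f //= ; have := ltn_ord i; have := ltn_ord j.
    by case: hm => [|r0]; nia.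
  by move=> i i' /fE[/(congr1 val) /= E _]; apply: val_inj.
- move=> j; apply/set0Pn; exists (f j (Ordinal k0)); exact: imset_f.
move=> j j' jj'; rewrite -setI_eq0; apply/eqP/setP=> x; rewrite !inE.
apply/negP=> /andP[/imsetP[i _ ->] /imsetP[i' _ /fE[_ E]]].
by rewrite E eqxx in jj'.
Qed.

(** * Last crossings and shadows *)

Lemma double_counting (T1 T2 : finType) (X : {set T1}) (Y : {set T2}) (r : T1 -> T2 -> bool) a b :
  (forall x, x \in X -> a <= #|[set y in Y | r x y]|) ->
  (forall y, y \in Y -> #|[set x in X | r x y]| <= b) -> a * #|X| <= b * #|Y|.
Proof.
move=> ha hb; rewrite -[#|X|]sum1_card -[#|Y|]sum1_card !big_distrr /= !muln1.
apply: leq_trans (_ : \sum_(x in X) \sum_(y in Y | r x y) 1 <= _).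
  by apply: leq_sum => x /ha; rewrite -sum1_card (eq_bigl _ _ (in_set _)).
rewrite (exchange_big_dep (mem Y)) /=; last by move=> ? ? _ /andP[].
apply: leq_sum => y yY; apply: leq_trans (hb y yY).
by rewrite -sum1_card; apply/eq_leq/eq_bigl => x; rewrite inE yY.
Qed.

Section LastCrossing.
Variables (n s : nat).
Implicit Types (A B : {set 'I_n}) (G H : {set {set 'I_n}}).

(** The offset [c] is 1 for members of H and 0 for sets of the shadow, which have lost one element.
    Indices above n satisfy the strict inequality automatically, so a bounded quantifier
    suffices. *)
Definition last_crossing c i A := (#|A :&: below n (i * s.+1 - 1)| == i + c) &&
  [forall j : 'I_n.+1, (i < j) ==> (#|A :&: below n (j * s.+1 - 1)| < j + c)].

Lemma last_crossingP c i A : reflect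
  (#|A :&: below n (i * s.+1 - 1)| = i + c /\
   forall j, i < j -> #|A :&: below n (j * s.+1 - 1)| < j + c)
  (last_crossing c i A).
Proof.
apply: (iffP andP) => [[/eqP -> /forallP H]|[-> H]]; split=> //; last first.
  by apply/forallP=> j; apply/implyP; apply: H.
move=> j ij; have [jn|nj] := ltnP j n.+1; first exact: (implyP (H (Ordinal jn))).
apply: leq_ltn_trans (subset_leq_card (subsetIl _ _)) _.
apply: leq_ltn_trans (max_card _) _; rewrite card_ord; lia.
Qed.

Lemma last_crossing_uniq c i j A : last_crossing c i A -> last_crossing c j A -> i = j.
Proof.
move=> /last_crossingP[ci Hi] /last_crossingP[cj Hj]; have [ij|ji|//] := ltngtP i j.
  by have := Hi _ ij; rewrite cj ltnn.
by have := Hj _ ji; rewrite ci ltnn.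
Qed.

(** The largest crossing index j works: the count in the next, longer segment is at most j + c,
    which forces equality at j. *)
Lemma exists_last_crossing c i A : 0 < i -> i + c <= #|A :&: below n (i * s.+1 - 1)| ->
  exists j, [/\ 0 < j, j + c <= #|A| & last_crossing c j A].
Proof.
move=> i0 ci; pose P j := (0 < j) && (j + c <= #|A :&: below n (j * s.+1 - 1)|).
have Pb j : P j -> j <= n.
  move=> /andP[_ h]; apply: leq_trans (leq_addr c j) (leq_trans h _).
  by apply: leq_trans (max_card _) _; rewrite card_ord.
have exP : exists j, P j by exists i; rewrite /P i0.
case: (ex_maxnP exP Pb) => j /andP[j0 cj] jmax.
have after m : j < m -> #|A :&: below n (m * s.+1 - 1)| < m + c.
  move=> jm; rewrite ltnNge; apply/negP=> h; suff : m <= j by rewrite leqNgt jm.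
  by apply: jmax; rewrite /P h (ltn_trans j0 jm).
exists j; split=> //; first exact: leq_trans cj (subset_leq_card (subsetIl _ _)).
apply/last_crossingP; split=> //; apply/eqP; rewrite eqn_leq cj andbT.
have := after j.+1 (ltnSn j); rewrite addSn ltnS; apply: leq_trans.
by apply: subset_leq_card; apply: setIS; apply: belowS; lia.
Qed.

Lemma sum_last_crossing_le c m G :
  \sum_(i < m) #|[set B in G | last_crossing c i B]| <= #|G|.
Proof.
rewrite -[#|G|]sum1_card; under [leqLHS]eq_bigr do rewrite -sum1dep_card.
rewrite (exchange_big_dep (mem G)) /=; last by move=> ? ? _ /andP[].
apply: leq_sum => B GB; rewrite (eq_bigl (fun i : 'I_m => last_crossing c i B)); last by move=> i; rewrite GB.
rewrite sum1_card; apply/card_le1_eqP => i j ci cj.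
by apply: val_inj; exact: (@last_crossing_uniq c _ _ B).
Qed.

Lemma card_le_sum_last_crossing c k H : (forall A, A \in H -> #|A| = k) ->
  (forall A, A \in H -> exists2 i, 0 < i & i + c <= #|A :&: below n (i * s.+1 - 1)|) ->
  #|H| <= \sum_(i < k.+1 | 0 < i) #|[set A in H | last_crossing c i A]|.
Proof.
move=> Hk HH; rewrite -[#|H|]sum1_card; under [leqRHS]eq_bigr do rewrite -sum1dep_card.
rewrite (exchange_big_dep (mem H)) /=; last by move=> ? ? _ /andP[].
apply: leq_sum => A HA; have [i i0 ci] := HH A HA.
have [j [j0 jA cj]] := exists_last_crossing i0 ci.
have jk : j < k.+1 by rewrite -(Hk A HA) ltnS (leq_trans (leq_addr c j)).
by rewrite (bigD1 (Ordinal jk)) //= HA j0 cj.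
Qed.

Lemma card_below m : #|below n m| <= m.
Proof.
rewrite -[leqRHS](card_ord m); have [mn|nm] := leqP m n; last first.
  by apply: leq_trans (max_card _) _; rewrite !card_ord; lia.
rewrite -(card_imset predT (f := widen_ord mn)); last by move=> x y /(congr1 val) /= /val_inj.
apply: subset_leq_card; apply/subsetP=> x; rewrite inE => xm.
by apply/imsetP; exists (Ordinal xm) => //; apply: val_inj.
Qed.

(* Delete from A in H an element of the initial segment where A crosses last. *)
Lemma last_crossing_shadow i G H : 0 < i ->
  (forall A y, A \in H -> y \in A -> A :\ y \in G) ->
  i.+1 * #|[set A in H | last_crossing 1 i A]| <=
  (i * s) * #|[set B in G | last_crossing 0 i B]|.
Proof.
move=> i0 HG; set U := below n (i * s.+1 - 1).
apply: (double_counting (r := fun A B => [exists y in A :&: U, B == A :\ y])).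
  (* All i + 1 deletions are admissible: [U] lies in every later segment, so each later count also
     drops by one. *)
  move=> A /setIdP[HA cA]; have /last_crossingP[ci Hi] := cA.
  rewrite -addn1 -ci -(card_in_imset (f := fun y => A :\ y)).
    apply: subset_leq_card; apply/subsetP=> _ /imsetP[y yAU ->].
    have /setIP[yA yU] := yAU.
    rewrite !inE HG //=; apply/andP; split; last by apply/exists_inP; exists y.
    have E m : y \in below n m -> #|(A :\ y) :&: below n m| = #|A :&: below n m| - 1.
      rewrite inE => ym; rewrite [in RHS](cardsD1 y) -setIDAC !inE yA ym.
      by rewrite add1n subn1.
    apply/last_crossingP; split; first by rewrite E // ci addn1 subn1 addn0.
    move=> j ij; have := Hi j ij; rewrite E ?addn0 ?addn1; last first.
      by apply: subsetP yU; apply: belowS; nia.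
    by move: #|A :&: _| => u; clear -ij; lia.
  move=> y z /setIP[yA _] /setIP[zA _] /setP/(_ y); rewrite !inE eqxx yA /= andbT.
  by move=> /esym/negbFE/eqP.
(* [B] arises only by deleting a point of [U] outside [B], which leaves at most i (s + 1) - 1 - i <=
   i s sets. *)
move=> B /setIdP[GB /last_crossingP[ci _]].
apply: (@leq_trans #|[set y |: B | y in U :\: B]|).
  apply: subset_leq_card; apply/subsetP=> A; move=> /setIdP[_ /exists_inP[y /setIP[yA yU] /eqP ->]].
  by apply/imsetP; exists y; [apply/setDP; rewrite in_setD1 eqxx | rewrite setD1K].
apply: leq_trans (leq_imset_card _ _) _; rewrite cardsD setIC ci addn0.
move: (card_below (i * s.+1 - 1)); rewrite -/U; move: #|U| => u; nia.
Qed.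
End LastCrossing.

Lemma mul_bin_bin h i r : r <= i -> i <= h -> 'C(h, i) * 'C(i, r) = 'C(h, r) * 'C(h - r, i - r).
Proof.
move=> ri ih.
have E1 := bin_fact ih; have E2 := bin_fact ri.
have E3 := bin_fact (leq_trans ri ih).
have ir : i - r <= h - r by rewrite leq_sub2r.
have := bin_fact ir; rewrite (_ : h - r - (i - r) = h - i); last by lia.
move=> E4; apply/eqP; rewrite -(eqn_pmul2r (m := r`! * (i - r)`! * (h - i)`!)); last first.
  by rewrite !muln_gt0 !fact_gt0.
apply/eqP; transitivity (h`!); first by rewrite -E1 -E2; ring.
by rewrite -E3 -E4; ring.
Qed.

Lemma card_belowE n m : m <= n -> #|below n m| = m.
Proof.
move=> mn; apply/eqP; rewrite eqn_leq card_below -{1}(card_ord m).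
rewrite -(card_imset predT (f := widen_ord mn)); last by move=> x y /(congr1 val) /= /val_inj.
by apply: subset_leq_card; apply/subsetP=> _ /imsetP[y _ ->]; rewrite inE /=.
Qed.

Lemma card_superset (T : finType) (R : {set T}) k :
  #|[set B : {set T} | (R \subset B) && (#|B| == k)]| <= 'C(#|T| - #|R|, k - #|R|).
Proof.
have -> : #|T| - #|R| = #|~: R| by rewrite [RHS]cardsCs setCK.
rewrite -cards_draws -(card_in_imset (f := fun B => B :\: R)).
  apply: subset_leq_card; apply/subsetP=> _ /imsetP[B /setIdP[RB /eqP Bk] ->].
  by rewrite inE setDE subsetIr -setDE cardsD (setIidPr RB) Bk /=.
move=> B C /setIdP[RB _] /setIdP[RC _] E.
by rewrite -(setID B R) -(setID C R) E (setIidPr RB) (setIidPr RC).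
Qed.

Section LastCrossingMoments.
Variables (n s l : nat).

Definition crossing_class i := [set B in ksubsets n l | last_crossing s 0 i B].

(* Conditionally on its tail, a uniform member of the i-th class is a uniform i-subset of
   the initial segment of length i(s+1)-1: compare members with the same tail. *)
Lemma crossing_class_moment i r : 0 < i -> i * s.+1 - 1 <= n ->
  #|crossing_class i| * 'C(i, r) <=
  'C(i * s.+1 - 1, r) * #|[set B in crossing_class i | below n r \subset B]|.
Proof.
move=> i0; set h := i * s.+1 - 1 => hn; set P := crossing_class i; set PR := [set B in P | _].
have [ir|ri] := ltnP i r; first by rewrite bin_small // muln0.
have [->|[B0 B0P]] := set_0Vmem P; first by rewrite cards0 mul0n.
set U := below n h; set R := below n r.
have cU : #|U| = h by rewrite card_belowE.
have PU B : B \in P -> #|B :&: U| = i.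
  by case/setIdP=> _ /last_crossingP[]; rewrite addn0.
have ih : i <= h by rewrite -(PU _ B0P) -cU subset_leq_card // subsetIr.
have RU : R \subset U by apply: belowS; apply: leq_trans ih.
have cR : #|R| = r by rewrite card_belowE // (leq_trans ri) // (leq_trans ih).
(* Pairs with equal tails outside [U]: any (i - r)-subset of [U :\: R], together with [R] and the
   tail of [A], is a set in [PR]; conversely a tail belongs to at most C(h, i) members of [P]. *)
have main : 'C(h - r, i - r) * #|P| <= 'C(h, i) * #|PR|.
  apply: (double_counting (r := fun A B => A :\: U == B :\: U)) => [A AP|B _].
    rewrite -{1}cU -cR -{1}(setIidPr RU) -cardsD -cards_draws.
    rewrite -(card_in_imset (f := fun S => S :|: R :|: A :\: U)).
      apply: subset_leq_card; apply/subsetP=> _ /imsetP[S /setIdP[SU /eqP cS] ->].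
      have [SU' SR] : S \subset U /\ [disjoint S & R] by apply/andP; rewrite -subsetD.
      set B := S :|: R :|: _.
      have BU : B :&: U = S :|: R.
        by rewrite setIUl setIUl (setIidPl SU') (setIidPl RU) setIC setIDA setIC -setIDA setDv setI0 setU0.
      have BD : B :\: U = A :\: U.
        have SU0 : S :\: U = set0 by apply/eqP; rewrite setD_eq0.
        have RU0 : R :\: U = set0 by apply/eqP; rewrite setD_eq0.
        by rewrite 2!setDUl SU0 RU0 !set0U setDDl setUid.
      (* Only the part inside [U] changes, and its size does not, so the last crossing and the total
         size of [A] carry over to [B]. *)
      have cB m : h <= m -> #|B :&: below n m| = #|A :&: below n m|.
        move=> hm; have sub : U \subset below n m by apply: belowS.
        rewrite -(cardsID U (B :&: _)) -(cardsID U (A :&: _)).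
        rewrite -!setIA !(setIidPr sub) BU (PU A AP) cardsU.
        rewrite (_ : S :&: R = set0) ?cards0 ?subn0; last by apply/eqP; rewrite setI_eq0.
        by rewrite cS cR subnK // -!setIDAC BD.
      have cBn : #|B| = #|A|.
        have fullT : below n n = setT by apply/setP=> x; rewrite !inE ltn_ord.
        by have := cB n hn; rewrite fullT !setIT.
      rewrite !inE BD eqxx andbT; apply/andP; split; last first.
        by rewrite /B -setUA setUCA subsetUl.
      move: AP; rewrite !inE cBn => /andP[-> /last_crossingP[ci Hi]] /=.
      apply/last_crossingP; split=> [|j ij]; rewrite cB //; first exact: Hi.
      by rewrite /h leq_sub2r // leq_mul2r ltnW ?orbT.
    move=> S S' /setIdP[SU _] /setIdP[SU' _] E.
    have aux (X : {set 'I_n}) : X \subset U :\: R -> X = (X :|: R :|: A :\: U) :&: (U :\: R).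
      move=> /subsetP XU; apply/setP=> x; rewrite !inE.
      by have := XU x; rewrite !inE; case: (x \in X) => [/(_ isT) ->|] //= _; case: (x < r) => //=; rewrite ?andbF //=; case: (x < h); rewrite ?andbF.
    by rewrite (aux S) // E -aux.
  rewrite -cU -cards_draws -(card_in_imset (f := fun A => A :&: U)).
    apply: subset_leq_card; apply/subsetP=> _ /imsetP[A /setIdP[AP _] ->].
    by rewrite inE subsetIr PU /=.
  move=> A A' /setIdP[_ /eqP E] /setIdP[_ /eqP E'] EU.
  by rewrite -(setID A U) -(setID A' U) EU E E'.
rewrite -(leq_pmul2l (m := 'C(h - r, i - r))) ?bin_gt0 ?leq_sub2r //.
rewrite mulnA [in leqRHS]mulnA -[in leqRHS](mulnC 'C(h, r)) -mul_bin_bin //.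
by rewrite [leqRHS]mulnAC leq_mul2r main orbT.
Qed.

Lemma sum_crossing_class_le r : r <= l -> l <= n ->
  \sum_(i < l.+1) #|[set B in crossing_class i | below n r \subset B]| <= 'C(n - r, l - r).
Proof.
move=> rl ln; pose G := [set B : {set 'I_n} | (below n r \subset B) && (#|B| == l)].
apply: (@leq_trans #|G|); last first.
  by have := card_superset (below n r) l; rewrite card_ord card_belowE // (leq_trans rl).
apply: leq_trans (sum_last_crossing_le s 0 l.+1 G); apply: leq_sum => i _.
by apply: subset_leq_card; apply/subsetP=> B; rewrite !inE => /andP[/andP[-> ->] ->].
Qed.
End LastCrossingMoments.

(** * The quadratic form of the Kneser graph *)

Section Kneser.
Variables (T : finType) (l : nat).
Implicit Types (f g : {set T} -> rat) (A B : {set T}).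
Local Open Scope ring_scope.

(** The adjacency operator of the Kneser graph on the [l]-subsets of [T]. *)
Definition kneser f A : rat := \sum_(B : {set T} | (#|B| == l) && [disjoint A & B]) f B.
Definition slice_dot f g : rat := \sum_(A : {set T} | #|A| == l) f A * g A.

Lemma kneser_sym f g : slice_dot f (kneser g) = slice_dot (kneser f) g.
Proof.
rewrite /slice_dot /kneser.
under eq_bigr do rewrite big_distrr /=.
under [RHS]eq_bigr do rewrite big_distrl /=.
rewrite (exchange_big_dep (fun A : {set T} => #|A| == l)) /=; last by move=> ? ? _ /andP[].
apply: eq_bigr => B cB; apply: eq_bigl => A; rewrite cB /= disjoint_sym.
by [].
Qed.

Lemma slice_dot_ge0 f : 0 <= slice_dot f f.
Proof. by apply: sumr_ge0 => A _; rewrite -expr2 sqr_ge0. Qed.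

Lemma slice_dot_eq0 f g : slice_dot f f = 0 -> slice_dot g f = 0.
Proof.
move=> /eqP; rewrite psumr_eq0; last by move=> A _; rewrite -expr2 sqr_ge0.
move=> /allP H; apply: big1 => A cA.
have := H A (mem_index_enum A); rewrite cA /= -expr2 sqrf_eq0 => /eqP ->.
by rewrite mulr0.
Qed.

Lemma slice_dot_CauchySchwarz f g : (slice_dot f g) ^+ 2 <= slice_dot f f * slice_dot g g.
Proof.
have [g0|g0] := eqVneq (slice_dot g g) 0; first by rewrite (slice_dot_eq0 _ g0) g0 mulr0 expr0n.
have gp : 0 < slice_dot g g by rewrite lt0r g0 slice_dot_ge0.
have expand a b : slice_dot (fun A => a * f A - b * g A) (fun A => a * f A - b * g A) =
    a ^+ 2 * slice_dot f f - 2 * a * b * slice_dot f g + b ^+ 2 * slice_dot g g.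
  by rewrite /slice_dot !big_distrr /= -sumrB -big_split /=; apply: eq_bigr => A _; ring.
have := slice_dot_ge0 (fun A => slice_dot g g * f A - slice_dot f g * g A).
rewrite expand (_ : _ + _ = slice_dot g g * (slice_dot f f * slice_dot g g - slice_dot f g ^+ 2)); last by ring.
by rewrite pmulr_rge0 // subr_ge0.
Qed.

(** A Lipschitz condition along the edges of the Johnson graph. *)
Definition swap_lipschitz (L : rat) f := forall A (x y : T),
  #|A| = l -> x \in A -> y \notin A -> `|f (tperm x y @: A) - f A| <= L.

Lemma card_tperm_imset (x y : T) A : #|tperm x y @: A| = #|A|.
Proof. by rewrite card_imset //; apply: perm_inj. Qed.

Lemma card_kneser_star A (y : T) : #|A| = l -> y \notin A ->
  (#|[set B : {set T} | [&& #|B| == l, [disjoint A & B] & y \in B]]| <= 'C(#|T| - l - 1, l - 1))%N.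
Proof.
move=> cA yA; have -> : (#|T| - l - 1)%N = #|~: (y |: A)|.
  by rewrite [RHS]cardsCs setCK cardsU1 yA cA subnDA subnAC.
rewrite -cards_draws -(card_in_imset (f := fun B => B :\ y)).
  apply: subset_leq_card; apply/subsetP=> _ /imsetP[B + ->].
  rewrite inE => /and3P[/eqP cB dB yB]; rewrite inE; apply/andP; split; last first.
    by have := cardsD1 y B; rewrite yB cB add1n => ->; rewrite subn1.
  apply/subsetP=> z /setD1P[/negbTE zy zB]; rewrite !inE zy /=.
  by rewrite (disjointFl dB zB).
move=> B C; rewrite !inE => /and3P[_ _ yB] /and3P[_ _ yC] E.
by rewrite -(setD1K yB) E setD1K.
Qed.

(* Swapping x for y in A changes the neighbourhood of A only in the sets containing y. *)
Lemma kneser_lipschitz L f : swap_lipschitz L f ->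
  swap_lipschitz ('C(#|T| - l - 1, l - 1)%:R * L) (kneser f).
Proof.
move=> Lf A x y cA xA yA.
have -> : kneser f (tperm x y @: A) =
    \sum_(B : {set T} | (#|B| == l) && [disjoint A & B]) f (tperm x y @: B).
  rewrite /kneser (reindex_inj (inv_inj (tperm_imsetK x y))) /=.
  apply: eq_bigl => B; rewrite card_tperm_imset imset_disjoint //; exact: perm_inj.
rewrite /kneser -sumrB; apply: le_trans (ler_norm_sum _ _ _) _.
have L0 : 0 <= L by apply: le_trans (Lf A x y cA xA yA).
rewrite (bigID (fun B : {set T} => y \in B)) /= [X in _ + X]big1 ?addr0; last first.
  move=> B /andP[/andP[_ dB] yB]; rewrite tperm_imset_id ?subrr ?normr0 //.
  by rewrite (disjointFr dB xA).
apply: (@le_trans _ _ (\sum_(B in [set B : {set T} | [&& #|B| == l, [disjoint A & B] & y \in B]]) L)).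
  rewrite [leRHS](eq_bigl (fun B : {set T} => (#|B| == l) && [disjoint A & B] && (y \in B))); last first.
    by move=> B; rewrite inE andbA.
  apply: ler_sum => B /andP[/andP[/eqP cB dB] yB]; rewrite tpermC; apply: Lf => //.
  by rewrite (disjointFr dB xA).
by rewrite sumr_const -[L *+ _]mulr_natl ler_wpM2r // ler_nat card_kneser_star.
Qed.

Lemma swap_lipschitz_diff L f A B : swap_lipschitz L f -> #|A| = l -> #|B| = l ->
  `|f A - f B| <= #|A :\: B|%:R * L.
Proof.
move=> Lf + cB; have [d] := ubnP #|A :\: B|; elim: d A => // d IH A; rewrite ltnS => cd cA.
have cAB : #|A :\: B| = #|B :\: A| by rewrite !cardsD cA cB setIC.
have [E|[x /setDP[xA xB]]] := set_0Vmem (A :\: B).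
  have -> : A = B by apply/eqP; rewrite eqEcard -setD_eq0 E eqxx cA cB leqnn.
  by rewrite subrr normr0 setDv cards0 mul0r.
have [y /setDP[yB yA]] : exists y, y \in B :\: A.
  by apply/set0Pn; rewrite -cards_eq0 -cAB cards_eq0; apply/set0Pn; exists x; apply/setDP.
have cD : #|A :\: B| = #|(tperm x y @: A) :\: B|.+1.
  rewrite (cardsD1 x (A :\: B)) !inE xA xB add1n; congr _.+1; apply: eq_card => z.
  rewrite tpermC tperm_imset_swap // !inE.
  by case: (eqVneq z y) => [->|_]; rewrite ?yB ?andbF //= andbCA.
rewrite cD -natr1 mulrDl mul1r -(subrKA (f (tperm x y @: A))) addrC.
apply: le_trans (ler_normD _ _) _; apply: lerD.
  by apply: IH; rewrite ?card_tperm_imset //; rewrite cD in cd.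
by rewrite distrC; apply: Lf.
Qed.

(** With mean zero, f(A) is the average of the differences f(A) - f(B), and [A] and [B] are at most
    [l] exchanges apart. *)
Lemma swap_lipschitz_sup L f : swap_lipschitz L f -> 0 <= L -> \sum_(A : {set T} | #|A| == l) f A = 0 ->
  forall A, #|A| = l -> `|f A| <= l%:R * L.
Proof.
move=> Lf L0 f0 A cA; pose V := [set B : {set T} | #|B| == l].
have V0 : 0 < #|V|%:R :> rat by rewrite ltr0n; apply/card_gt0P; exists A; rewrite inE cA.
rewrite -(ler_pM2l V0) -[X in X * `|_|](@ger0_norm _ _) ?ler0n // -normrM.
have -> : #|V|%:R * f A = \sum_(B in V) (f A - f B).
  rewrite sumrB sumr_const mulr_natl [X in _ - X](_ : _ = 0) ?subr0 // -[RHS]f0.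
  by apply: eq_bigl => B; rewrite inE.
apply: le_trans (ler_norm_sum _ _ _) _.
have -> : #|V|%:R * (l%:R * L) = \sum_(B in V) l%:R * L by rewrite sumr_const mulr_natl.
apply: ler_sum => B; rewrite inE => /eqP cB; apply: le_trans (swap_lipschitz_diff Lf cA cB) _.
by rewrite ler_wpM2r // ler_nat -cA subset_leq_card // subsetDl.
Qed.

(** Regularity of the Kneser graph; it keeps the mean zero under iteration. *)
Lemma kneser_sum f : \sum_(A : {set T} | #|A| == l) kneser f A =
  'C(#|T| - l, l)%:R * \sum_(A : {set T} | #|A| == l) f A.
Proof.
rewrite /kneser (exchange_big_dep (fun A : {set T} => #|A| == l)) /=; last by move=> ? ? _ /andP[].
rewrite big_distrr /=; apply: eq_bigr => B /eqP cB; rewrite sumr_const mulr_natl.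
congr (_ *+ _); rewrite -cB -(cardsC B) addKn -cards_draws; apply: eq_card => A.
by rewrite !inE unfold_in cB eqxx /= andbC -disjoints_subset.
Qed.
End Kneser.

Section KneserGrowth.
Local Open Scope ring_scope.

Lemma Bernoulli (R : realDomainType) (r : R) k : 1 <= r -> 1 + k%:R * (r - 1) <= r ^+ k.
Proof.
move=> r1; elim: k => [|k IH]; first by rewrite mul0r addr0 expr0.
rewrite exprS -natr1; apply: (@le_trans _ _ (r * (1 + k%:R * (r - 1)))).
  have : 0 <= k%:R * (r - 1) * (r - 1) by rewrite !mulr_ge0 ?ler0n ?subr_ge0.
  nra.
by rewrite ler_wpM2l // (le_trans ler01).
Qed.

(* If a(1) = r p a(0) with r > 1, then a(2^m) >= a(0) (r p)^(2^m) outgrows C p^(2^m). *)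
Lemma doubling_growth (a : nat -> rat) (p C : rat) : 0 <= a 0%N -> 0 < p ->
  (forall m, a m ^+ 2 <= a 0%N * a (m + m)%N) -> (forall m, a m <= C * p ^+ m) ->
  a 1%N <= p * a 0%N.
Proof.
move=> a0 p0 dbl bnd; rewrite leNgt; apply/negP => lt1.
have {}a0 : 0 < a 0%N.
  rewrite lt0r a0 andbT; apply/negP => /eqP E; move: (dbl 1%N) lt1.
  by rewrite E mul0r mulr0 => h1 h2; have := exprn_gt0 2 h2; rewrite ltNge h1.
pose r := a 1%N / (p * a 0%N).
have pa0 : 0 < p * a 0%N by rewrite mulr_gt0.
have r1 : 1 < r by rewrite /r ltr_pdivlMr // mul1r.
have low m : a 0%N * (r * p) ^+ (2 ^ m) <= a (2 ^ m)%N.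
  elim: m => [|m IH].
    rewrite expn0 expr1 /r (_ : _ * _ = a 1%N) //.
    by field; rewrite !gt_eqF.
  rewrite expnS mul2n -addnn -(ler_pM2l a0) (le_trans _ (dbl _)) // exprD.
  rewrite [leLHS](_ : _ = (a 0%N * (r * p) ^+ (2 ^ m)) ^+ 2); last first.
    by move: ((r * p) ^+ (2 ^ m)) => u; ring.
  have u0 : 0 <= a 0%N * (r * p) ^+ (2 ^ m).
    by rewrite mulr_ge0 ?(ltW a0) // exprn_ge0 // mulr_ge0 ?(ltW p0) // ltW ?(lt_trans ltr01).
  by apply: lerXn2r; rewrite ?nnegrE ?(le_trans u0 IH).
(* Bernoulli's inequality turns the excess factor r^(2^m) into growth linear in 2^m, against the
   fixed bound C / a(0). *)
have up m : 1 + (2 ^ m)%:R * (r - 1) <= C / a 0%N.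
  apply: le_trans (Bernoulli _ (ltW r1)) _; rewrite ler_pdivlMr // mulrC.
  by rewrite -(ler_pM2r (exprn_gt0 (2 ^ m) p0)) -mulrA -exprMn (le_trans (low m)).
have r10 : 0 < r - 1 by rewrite subr_gt0.
have q0 : 0 <= (C / a 0%N) / (r - 1).
  by rewrite divr_ge0 ?(ltW r10) // (le_trans _ (up 0%N)) // addr_ge0 ?ler01 // mulr_ge0 ?ler0n // ltW.
have := archi_boundP q0; set m := Num.bound _; rewrite ltr_pdivrMr // => lt2.
have := up m; rewrite leNgt => /negP; apply; apply: (lt_le_trans lt2).
rewrite ler_wpDl ?ler01 // ler_pM2r // ler_nat ltnW //.
exact: ltn_expl.
Qed.

Section KneserForm.
Variables (T : finType) (l : nat).
Implicit Types (f g : {set T} -> rat) (A B : {set T}).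
Local Notation K := (@kneser T l).
Local Notation "'[ f , g ]" := (@slice_dot T l f g).

Lemma slice_dot_iter f g m : '[f, iter m K g] = '[iter m K f, g].
Proof. by elim: m f => //= m IH f; rewrite kneser_sym IH -iterSr. Qed.

(* For a function of mean zero, iterating the contraction of Lipschitz constants bounds
   <f, K^m f> by C p^m; by Cauchy-Schwarz the ratio <f, Kf> / <f, f> is then at most p. *)
Lemma kneser_form_le f (p := 'C(#|T| - l - 1, l - 1)) : (0 < p)%N ->
  \sum_(A : {set T} | #|A| == l) f A = 0 -> '[f, K f] <= p%:R * '[f, f].
Proof.
move=> p0 f0; pose S : rat := \sum_(A : {set T} | #|A| == l) `|f A|.
have fS A : #|A| = l -> `|f A| <= S.
  by move=> cA; rewrite /S (bigD1 A) ?cA //= ler_wpDr // sumr_ge0.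
have S0 : 0 <= S by apply: sumr_ge0.
(* An exchange changes f by at most 2 [S], and every application of [K] multiplies the Lipschitz
   constant by p. *)
pose L m : rat := p%:R ^+ m * (S + S).
have L0 m : 0 <= L m by rewrite mulr_ge0 ?exprn_ge0 ?ler0n // addr_ge0.
have lipm m : swap_lipschitz l (L m) (iter m K f).
  elim: m => [|m IH]; last by rewrite /L exprS -mulrA; apply: kneser_lipschitz.
  move=> A x y cA _ _; rewrite /L expr0 mul1r; apply: le_trans (ler_normB _ _) _.
  by apply: lerD; apply: fS; rewrite ?card_tperm_imset.
have summ m : \sum_(A : {set T} | #|A| == l) iter m K f A = 0.
  by elim: m => [|m IH] //=; rewrite kneser_sum IH mulr0.
apply: (@doubling_growth (fun m => '[f, iter m K f]) _ (S * (l%:R * (S + S)))) => /=.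
- exact: slice_dot_ge0.
- by rewrite ltr0n.
- move=> m; rewrite iterD [X in _ * X]slice_dot_iter; exact: slice_dot_CauchySchwarz.
move=> m; rewrite /slice_dot -mulrA big_distrl /=; apply: ler_sum => A /eqP cA.
apply: le_trans (ler_norm _) _; rewrite normrM ler_wpM2l //.
apply: le_trans (swap_lipschitz_sup (lipm m) (L0 m) (summ m) cA) _.
by rewrite /L -mulrA ler_wpM2l ?ler0n // mulrC.
Qed.

Definition disjoint_pairs (G : {set {set T}}) : nat :=
  #|[set p : {set T} * {set T} | [&& p.1 \in G, p.2 \in G & [disjoint p.1 & p.2]]]|.

(** One side of the expander mixing lemma: the indicator of [G] is its mean [al] plus a mean-zero
    part, to which [kneser_form_le] applies. *)
Lemma disjoint_pairs_le (G : {set {set T}}) (D := 'C(#|T|, l)) (d := 'C(#|T| - l, l))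
    (p := 'C(#|T| - l - 1, l - 1)) :
  (0 < p)%N -> (0 < D)%N -> (forall A, A \in G -> #|A| = l) ->
  (disjoint_pairs G * D <= (#|G| * d + p * D) * #|G|)%N.
Proof.
move=> p0 D0 Gl; suff le : (disjoint_pairs G)%:R <= #|G|%:R / D%:R * d%:R * #|G|%:R + p%:R * #|G|%:R :> rat.
  have D0' : 0 < D%:R :> rat by rewrite ltr0n.
  move: le; rewrite -(ler_pM2r D0') -(ler_nat rat) !(natrM, natrD) => /le_trans; apply.
  by rewrite le_eqVlt; apply/orP; left; apply/eqP; field; rewrite gt_eqF.
pose al : rat := #|G|%:R / D%:R; pose i A : rat := (A \in G)%:R.
have D0' : D%:R != 0 :> rat by rewrite pnatr_eq0 -lt0n.
have Gi (F : {set T} -> rat) : \sum_(A : {set T} | #|A| == l) i A * F A = \sum_(A in G) F A.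
  rewrite (bigID (mem G)) /= [X in _ + X]big1 ?addr0; last first.
    by move=> A /andP[_ /negbTE AG]; rewrite /i AG mul0r.
  apply: eq_big => [A|A /andP[_ AG]]; last by rewrite /i AG mul1r.
  by case: (boolP (A \in G)) => [/Gl ->|_]; rewrite ?eqxx ?andbF.
have sumi : \sum_(A : {set T} | #|A| == l) i A = #|G|%:R.
  by rewrite -[RHS]mulr1 mulr_natl -sumr_const -Gi; apply: eq_bigr => A _; rewrite mulr1.
have sum1 : \sum_(A : {set T} | #|A| == l) (1 : rat) = D%:R.
  by rewrite sumr_const /D -card_draws; congr _%:R; apply: eq_card => A; rewrite !inE.
have degK A : #|A| = l -> kneser l (fun=> 1) A = d%:R.
  move=> cA; rewrite /kneser sumr_const /d -cA -{1}(cardsC A) addKn -cards_draws; congr _%:R.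
  by apply: eq_card => B; rewrite !inE unfold_in cA andbC disjoint_sym -disjoints_subset.
pose f A := i A - al.
have f0 : \sum_(A : {set T} | #|A| == l) f A = 0.
  rewrite /f sumrB sumi; have -> : \sum_(A : {set T} | #|A| == l) al = al * D%:R.
    by rewrite -sum1 big_distrr /=; apply: eq_bigr => A _; rewrite mulr1.
  by rewrite /al divfK // subrr.
have Kf A : #|A| = l -> K f A = K i A - al * d%:R.
  move=> cA; rewrite /kneser /f sumrB -(degK A cA) /kneser big_distrr /=; congr (_ - _).
  by apply: eq_bigr => B _; rewrite mulr1.
have Ki : '[i, K i] = (disjoint_pairs G)%:R.
  rewrite /slice_dot Gi /disjoint_pairs -sum1_card natr_sum.
  rewrite (eq_bigl (fun p => (p.1 \in G) && ((p.2 \in G) && [disjoint p.1 & p.2]))); last by move=> ?; rewrite inE.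
  rewrite -(pair_big_dep (mem G) (fun A B => (B \in G) && [disjoint A & B]) (fun _ _ => 1)) /=.
  apply: eq_bigr => A AG; rewrite /kneser (bigID (mem G)) /= [X in X + _ = _](eq_bigr (fun=> 1)); last first.
    by move=> B /andP[_ BG]; rewrite /i BG.
  rewrite [X in _ + X]big1 ?addr0; last first.
    by move=> B /andP[_ /negbTE BG]; rewrite /i BG.
  by apply: eq_bigl => B; case: (boolP (B \in G)) => [/Gl ->|_]; rewrite ?eqxx ?andbF ?andbT.
have := kneser_form_le p0 f0.
have -> : '[f, K f] = (disjoint_pairs G)%:R - al * d%:R * #|G|%:R.
  rewrite -Ki /slice_dot -[X in _ - _ * X]sumi big_distrr /= -sumrB.
  have E0 : \sum_(A : {set T} | #|A| == l) al * K f A = 0 by rewrite -big_distrr /= kneser_sum f0 !mulr0.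
  rewrite -[LHS]addr0 -[X in _ + X = _]E0 -big_split /=; apply: eq_bigr => A /eqP cA.
  by rewrite (Kf A cA) /f; ring.
have -> : '[f, f] = #|G|%:R - al * #|G|%:R.
  rewrite /slice_dot; have E0 : \sum_(A : {set T} | #|A| == l) al * f A = 0 by rewrite -big_distrr /= f0 mulr0.
  rewrite -[LHS]addr0 -[X in _ + X = _]E0 -sumi big_distrr /= -sumrB -big_split /=; apply: eq_bigr => A _.
  by rewrite /f /i; case: (A \in G) => /=; ring.
have : 0 <= p%:R * (al * #|G|%:R) :> rat by rewrite /al !mulr_ge0 ?invr_ge0 ?ler0n.
rewrite -/al mulrBr; lra.
Qed.
End KneserForm.
End KneserGrowth.

(** * Random placements of disjoint blocks *)

(** Elements are exchanged one at a time by transpositions inside [U]. Fixing the complement allows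
    a second set to be moved without disturbing the first. *)
Lemma perm_of_card (T : finType) (U A A' : {set T}) : A \subset U -> A' \subset U ->
  #|A| = #|A'| -> exists2 r : {perm T}, r @: A = A' & forall z, z \notin U -> r z = z.
Proof.
move=> + AU'; have [d] := ubnP #|A :\: A'|; elim: d A => // d IH A; rewrite ltnS => cd AU cA.
have [E|[x /setDP[xA xA']]] := set_0Vmem (A :\: A').
  exists 1%g => [|z _]; last by rewrite perm1.
  rewrite (eq_imset _ (@perm1 T)) imset_id; apply/eqP.
  by rewrite eqEcard -setD_eq0 E eqxx cA leqnn.
have [y /setDP[yA' yA]] : exists y, y \in A' :\: A.
  apply/set0Pn; rewrite -cards_eq0 cardsD -cA setIC -cardsD cards_eq0.
  by apply/set0Pn; exists x; apply/setDP.
have [xU yU] : x \in U /\ y \in U by rewrite (subsetP AU) // (subsetP AU').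
have tE := tperm_imset_swap xA yA.
have [||| r rA rU] := IH (tperm y x @: A).
- apply: leq_trans cd; rewrite (cardsD1 x (A :\: A')) !inE xA xA' add1n ltnS.
  apply: subset_leq_card; apply/subsetP=> z; rewrite tE !inE => /andP[zA' /orP[/eqP E|]].
    by rewrite E yA' in zA'.
  by move=> /andP[-> ->]; rewrite zA'.
- apply/subsetP=> z; rewrite tE !inE => /orP[/eqP -> //|/andP[_]]; exact: (subsetP AU).
- by rewrite card_tperm_imset.
exists (tperm y x * r)%g => [|z zU].
  by rewrite -rA -imset_comp; apply: eq_imset => z; rewrite permM.
rewrite permM tpermD ?rU //; by apply: contraNneq zU => <-.
Qed.

(** By transitivity the sum over r is the same for every starting point in [O]; summing over [O] and
    using that each r permutes [O] gives the identity. *)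
Lemma orbit_average (T X : finType) (act : {perm T} -> X -> X) (O : {set X}) (phi : X -> nat) x :
  (forall r, injective (act r)) -> (forall r y, y \in O -> act r y \in O) ->
  (forall r s y, act (r * s)%g y = act s (act r y)) ->
  (forall y z, y \in O -> z \in O -> exists r, act r y = z) -> x \in O ->
  (\sum_(r : {perm T}) phi (act r x)) * #|O| = #|{perm T}| * \sum_(y in O) phi y.
Proof.
move=> actI actO actM tr xO.
have const y : y \in O -> \sum_r phi (act r y) = \sum_r phi (act r x).
  move=> yO; have [r <-] := tr x y xO yO; rewrite [RHS](reindex_inj (mulgI r)).
  by apply: eq_bigr => s _; rewrite actM.
rewrite mulnC -sum_nat_const -(eq_bigr _ const) exchange_big /= -sum_nat_const.
apply: eq_bigr => r _; rewrite -(big_imset phi) /=; last by move=> ? ? _ _; apply: actI.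
apply: eq_bigl => y; suff -> : act r @: O = O by [].
apply/eqP; rewrite eqEcard card_imset ?leqnn ?andbT //.
by apply/subsetP=> _ /imsetP[z zO ->]; apply: actO.
Qed.

Section Blocks.
Variables (n l t : nat).
Hypotheses (l0 : 0 < l) (tl : t * l <= n).
Local Notation D := 'C(n, l).
Local Notation P := #|{perm 'I_n}|.

Definition block (j : 'I_t) : {set 'I_n} := [set x : 'I_n | (j * l <= x) && (x < j.+1 * l)].

Lemma card_block j : #|block j| = l.
Proof.
have jt : j.+1 * l <= n by apply: leq_trans tl; rewrite leq_mul2r ltn_ord orbT.
have := card_belowE jt; rewrite (_ : below n _ = below n (j * l) :|: block j); last first.
  by apply/setP=> x; rewrite !inE mulSn; apply/idP/idP; lia.
rewrite cardsU card_belowE ?(leq_trans _ jt) ?leq_mul2r ?leqnSn ?orbT //.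
rewrite (_ : _ :&: _ = set0) ?cards0; last by apply/setP=> x; rewrite !inE; lia.
by rewrite mulSn subn0; lia.
Qed.

Lemma block_disjoint i j : i != j -> [disjoint block i & block j].
Proof.
move=> ij; rewrite -setI_eq0; apply/eqP/setP=> x; rewrite !inE.
apply/negP=> /andP[/andP[h1 h2] /andP[h3 h4]]; move/negP: ij; apply; apply/eqP/val_inj => /=; nia.
Qed.

Lemma sum_perm_block (G : {set {set 'I_n}}) j : (forall A, A \in G -> #|A| = l) ->
  (\sum_(r : {perm 'I_n}) (r @: block j \in G)) * D = P * #|G|.
Proof.
move=> Gl; pose O := [set A : {set 'I_n} | #|A| == l].
have -> : D = #|O| by rewrite card_draws card_ord.
have := @orbit_average _ _ (fun (r : {perm 'I_n}) (A : {set 'I_n}) => r @: A) O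
  (fun A => A \in G : nat) (block j).
move=> -> => [||r A|r u A|A B|]; rewrite ?inE ?card_block //.
- rewrite -sum1_card big_mkcond [in RHS]big_mkcond /=; congr (_ * _).
  by apply: eq_bigr => A _; rewrite inE; case: (boolP (A \in G)) => [/Gl ->|_]; rewrite ?eqxx //; case: ifP.
- by move=> r; apply/imset_inj/perm_inj.
- by rewrite card_imset //; apply: perm_inj.
- by rewrite -imset_comp; apply: eq_imset => z; rewrite permM.
move=> /eqP cA /eqP cB; have [|r rA _] := @perm_of_card _ setT A B (subsetT _) (subsetT _).
  by rewrite cA.
by exists r.
Qed.

Lemma card_disjoint_pairs :
  #|[set p : {set 'I_n} * {set 'I_n} | [&& #|p.1| == l, #|p.2| == l & [disjoint p.1 & p.2]]]|
  = D * 'C(n - l, l).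
Proof.
rewrite -sum1_card (eq_bigl (fun p : {set 'I_n} * {set 'I_n} => (#|p.1| == l) && ((#|p.2| == l) && [disjoint p.1 & p.2]))); last first.
  by move=> p; rewrite inE.
rewrite -(pair_big_dep (fun A : {set 'I_n} => #|A| == l)
  (fun A B : {set 'I_n} => (#|B| == l) && [disjoint A & B]) (fun _ _ => 1)) /=.
transitivity (\sum_(A in [set A : {set 'I_n} | #|A| == l]) 'C(n - l, l)).
  apply: eq_big => [A|A /eqP cA]; first by rewrite inE.
  rewrite sum1_card; have -> : n - l = #|~: A| by rewrite [RHS]cardsCs setCK card_ord cA.
  rewrite -cards_draws.
  by apply: eq_card => B; rewrite !inE unfold_in andbC disjoint_sym -disjoints_subset.
by rewrite sum_nat_const card_draws card_ord.
Qed.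

Lemma sum_perm_block2 (G : {set {set 'I_n}}) i j : (forall A, A \in G -> #|A| = l) -> i != j ->
  (\sum_(r : {perm 'I_n}) ((r @: block i \in G) * (r @: block j \in G))) * (D * 'C(n - l, l))
  = P * disjoint_pairs G.
Proof.
move=> Gl ij; rewrite -card_disjoint_pairs; set O := [set p | _].
have := @orbit_average _ _ (fun (r : {perm 'I_n}) (p : {set 'I_n} * {set 'I_n}) => (r @: p.1, r @: p.2)) O
  (fun p => (p.1 \in G) * (p.2 \in G)) (block i, block j).
move=> -> => [||r A|r u A|A B|].
- rewrite /disjoint_pairs -sum1_card big_mkcond [in RHS]big_mkcond /=; congr (_ * _).
  apply: eq_bigr => -[A B] _; rewrite !inE /=.
  case: (boolP (A \in G)) => [/Gl ->|_]; case: (boolP (B \in G)) => [/Gl ->|_]; rewrite ?eqxx //=.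
  - by case: ifP.
  - by case: ifP.
  - by case: ifP.
- by move=> r [A B] [A' B'] [/(imset_inj (@perm_inj _ r)) -> /(imset_inj (@perm_inj _ r)) ->].
- rewrite !inE /= !card_imset; try exact: perm_inj.
  by rewrite imset_disjoint //; apply: perm_inj.
- by rewrite /= -!imset_comp; congr (_, _); apply: eq_imset => z; rewrite permM.
- case: A B => [A B] [A' B']; rewrite !inE /= => /and3P[/eqP cA /eqP cB dAB] /and3P[/eqP cA' /eqP cB' dAB'].
  have [|r rA _] := @perm_of_card _ setT A A' (subsetT _) (subsetT _); first by rewrite cA.
  (* After [r] has placed the first set, [q] places the second while fixing [A'] pointwise. *)
  have [|||q qB qC] := @perm_of_card _ (~: A') (r @: B) B'.
  - rewrite -disjoints_subset -rA disjoint_sym imset_disjoint //; exact: perm_inj.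
  - by rewrite -disjoints_subset disjoint_sym.
  - by rewrite card_imset ?cB //; apply: perm_inj.
  exists (r * q)%g; congr (_, _).
    rewrite -[RHS]imset_id -rA -imset_comp; apply: eq_in_imset => z zA /=.
    by rewrite permM qC // inE negbK -rA imset_f.
  by rewrite -qB -imset_comp; apply: eq_imset => z; rewrite permM.
by rewrite !inE /= !card_block !eqxx block_disjoint.
Qed.

Definition hits (G : {set {set 'I_n}}) (r : {perm 'I_n}) : nat := \sum_(j < t) (r @: block j \in G).

Local Open Scope ring_scope.

Lemma sum_hits (R : realFieldType) (G : {set {set 'I_n}}) : (forall A, A \in G -> #|A| = l) -> (l <= n)%N ->
  \sum_(r : {perm 'I_n}) (hits G r)%:R = P%:R * (t%:R * (#|G|%:R / D%:R)) :> R.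
Proof.
move=> Gl ln; have D0 : D%:R != 0 :> R by rewrite pnatr_eq0 -lt0n bin_gt0.
apply: (mulIf D0); rewrite -[RHS]mulrA -(mulrA t%:R) divfK //.
rewrite -natr_sum -!natrM; congr _%:R; rewrite /hits exchange_big /= big_distrl /=.
under eq_bigr do rewrite sum_perm_block //.
by rewrite sum_nat_const card_ord mulnCA.
Qed.

(** The diagonal contributes mu. By [disjoint_pairs_le] distinct blocks contribute at most mu^2 + (t
    - 1) (p / d) mu, where (t - 1) p <= d. *)
Lemma sum_hits_sqr (R : realFieldType) (G : {set {set 'I_n}}) (mu := t%:R * (#|G|%:R / D%:R) : R) :
  (1 < t)%N -> (forall A, A \in G -> #|A| = l) ->
  \sum_(r : {perm 'I_n}) (hits G r)%:R ^+ 2 <= P%:R * (mu ^+ 2 + 2 * mu).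
Proof.
move=> t1 Gl.
have ln2 : (l + l <= n)%N by apply: leq_trans tl; rewrite addnn -mul2n leq_mul2r t1 orbT.
have ln : (l <= n)%N by apply: leq_trans ln2; apply: leq_addr.
pose d := 'C(n - l, l); pose p := 'C(n - l - 1, l - 1).
have D0 : (0 < D)%N by rewrite bin_gt0.
have d0 : (0 < d)%N by rewrite bin_gt0; lia.
have p0 : (0 < p)%N by rewrite bin_gt0; lia.
(* Here p / d = l / (n - l), and t l <= n gives (t - 1) l <= n - l. *)
have pd : ((t - 1) * p <= d)%N.
  rewrite -(leq_pmul2l l0) mulnCA mulnA.
  have -> : (l * d = (n - l) * p)%N.
    have := mul_bin_diag (n - l) (l - 1); rewrite /p /d (_ : (l - 1).+1 = l); last by lia.
    by rewrite -subn1.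
  by rewrite -mulnA mulnA leq_mul2r [X in _ || X](_ : _ = true) ?orbT //; nia.
have E (r : {perm 'I_n}) : (hits G r ^ 2 = hits G r +
    \sum_(i < t) \sum_(j < t | i != j) (r @: block i \in G) * (r @: block j \in G))%N.
  rewrite expnS expn1 {1 2}/hits big_distrl /= /hits -big_split; apply: eq_bigr => i _.
  rewrite big_distrr /= (bigD1 i) //=; congr (_ + _)%N; first by case: (_ \in _).
  by apply: eq_bigl => j; rewrite eq_sym.
pose S2 := (\sum_(i < t) \sum_(j < t | i != j)
    \sum_(r : {perm 'I_n}) (r @: block i \in G) * (r @: block j \in G))%N.
have -> : \sum_(r : {perm 'I_n}) (hits G r)%:R ^+ 2 = P%:R * mu + S2%:R.
  under eq_bigr do rewrite -natrX E natrD.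
  rewrite big_split /= sum_hits //; congr (_ + _); rewrite -natr_sum; congr _%:R.
  by rewrite exchange_big; apply: eq_bigr => i _; rewrite exchange_big.
have ES : (S2 * (D * d) = t * (t - 1) * (P * disjoint_pairs G))%N.
  rewrite /S2 big_distrl /= (eq_bigr (fun=> (t - 1) * (P * disjoint_pairs G))%N) => [|i _].
    by rewrite sum_nat_const card_ord mulnA.
  rewrite big_distrl /= (eq_bigr (fun=> P * disjoint_pairs G)%N) => [|j ij]; last exact: sum_perm_block2.
  rewrite sum_nat_const; congr (_ * _)%N.
  by have := cardC1 i; rewrite card_ord subn1 => <-; apply: eq_card => j; rewrite !inE eq_sym.
have := @disjoint_pairs_le _ l G; rewrite card_ord -/p -/d => /(_ p0 D0 Gl) dpG.
have D0' : 0 < D%:R :> R by rewrite ltr0n.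
have d0' : 0 < d%:R :> R by rewrite ltr0n.
have {}ES : S2%:R * (D%:R * d%:R) = t%:R * (t - 1)%N%:R * (P%:R * (disjoint_pairs G)%:R) :> R.
  by rewrite -!natrM ES.
have {}pd : (t - 1)%N%:R * p%:R <= d%:R :> R by rewrite -natrM ler_nat.
have {}dpG : (disjoint_pairs G)%:R <= #|G|%:R / D%:R * d%:R * #|G|%:R + p%:R * #|G|%:R :> R.
  rewrite -(ler_pM2r D0'); move: dpG; rewrite -(ler_nat R) !(natrM, natrD) => /le_trans; apply.
  by rewrite le_eqVlt; apply/orP; left; apply/eqP; field; rewrite gt_eqF.
have t1' : (t - 1)%N%:R <= t%:R :> R by rewrite ler_nat leq_subr.
suff : S2%:R <= P%:R * (mu ^+ 2 + mu) by lra.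
rewrite -(ler_pM2r (mulr_gt0 D0' d0')) ES.
pose g : R := #|G|%:R.
have g0 : 0 <= g by rewrite ler0n.
have -> : P%:R * (mu ^+ 2 + mu) * (D%:R * d%:R) =
   P%:R * (t%:R * (t%:R * (g / D%:R * d%:R * g) + d%:R * g)).
  by rewrite /mu -/g; field; rewrite gt_eqF.
rewrite [leLHS](_ : _ = P%:R * (t%:R * ((t - 1)%N%:R * (disjoint_pairs G)%:R))); last by ring.
rewrite ler_wpM2l ?ler0n // ler_wpM2l ?ler0n //.
apply: le_trans (ler_wpM2l (ler0n _ _) dpG) _; rewrite -/g mulrDr lerD //.
  by rewrite ler_wpM2r // !mulr_ge0 ?invr_ge0 ?ler0n // ltW.
by rewrite mulrA ler_wpM2r.
Qed.
End Blocks.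

(** * Cross-dependent families *)

(** When the turn of [Y r] comes, only r elements have been used. *)
Lemma greedy_representatives (T : finType) (Y : nat -> {set T}) m :
  (forall r, r < m -> r < #|Y r|) ->
  exists w : seq T, [/\ size w = m, uniq w & forall x r, r < m -> nth x w r \in Y r].
Proof.
elim: m => [|m IH] HY; first by exists [::].
have [w [sw uw Yw]] := IH (fun r rm => HY r (ltnW rm)).
have /subsetPn[x xY xw] : ~~ (Y m \subset w).
  apply/negP=> /subset_leq_card; rewrite leqNgt => /negP; apply.
  by apply: leq_ltn_trans (card_size w) _; rewrite sw HY.
exists (rcons w x); split; first by rewrite size_rcons sw.
  by rewrite rcons_uniq uw andbT.
move=> y r; rewrite ltnS leq_eqVlt nth_rcons sw => /orP[/eqP ->|rm]; first by rewrite ltnn eqxx.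
by rewrite rm Yw.
Qed.

Section CrossDependent.
Variables (n l t s : nat).
Hypotheses (l0 : 0 < l) (tl : t * l <= n).
Variable F : nat -> {set {set 'I_n}}.

Definition cross_dependent := forall A : nat -> {set 'I_n}, (forall i, i <= s -> A i \in F i) ->
  exists i j, [/\ i <= s, j <= s, i != j & ~~ [disjoint A i & A j]].

Lemma hitsE (G : {set {set 'I_n}}) r : hits l t G r = #|[set j : 'I_t | r @: block n l j \in G]|.
Proof. by rewrite -sum1dep_card big_mkcond; apply: eq_bigr => j _; case: ifP. Qed.

Lemma hits_le (G : {set {set 'I_n}}) r : hits l t G r <= t.
Proof. by rewrite hitsE -[leqRHS]card_ord max_card. Qed.

Lemma hits_subset (G G' : {set {set 'I_n}}) r : G \subset G' -> hits l t G r <= hits l t G' r.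
Proof.
by move=> /subsetP GG; rewrite !hitsE; apply: subset_leq_card; apply/subsetP=> j; rewrite !inE => /GG.
Qed.

(* If F i met at least s + 1 - i blocks for every i, blocks could be assigned greedily
   starting from i = s; hence some F i meets at most v = s - i of them. *)
Lemma cross_dependent_hits (r : {perm 'I_n}) : cross_dependent ->
  (forall i j, i <= j -> j <= s -> F j \subset F i) ->
  exists v, [/\ hits l t (F s) r <= v, v <= s &
    \sum_(0 <= i < s) hits l t (F i) r <= (s - v) * t + v * v].
Proof.
move=> cd nest.
have [/existsP[i hi]|] := boolP [exists i : 'I_s.+1, hits l t (F i) r <= s - i].
  have is_ : i <= s by rewrite -ltnS.
  (* The first i = s - v families get at most t hits each, the remaining v at most v each. *)
  exists (s - i); split; rewrite ?leq_subr ?subKn //.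
    by apply: leq_trans hi; apply/hits_subset/nest.
  rewrite (@big_cat_nat _ _ _ i) //= leq_add //.
    rewrite -[X in X * t](subn0 (i : nat)) -sum_nat_const_nat.
    by apply: leq_sum => j _; apply: hits_le.
  rewrite -sum_nat_const_nat !big_nat; apply: leq_sum => j /andP[ij js].
  by apply: leq_trans hi; apply/hits_subset/nest => //; apply: ltnW.
rewrite negb_exists => /forallP H.
(* Reversing the order makes the sizes fit: [Y q] now has more than q elements. *)
pose Y q := [set j : 'I_t | r @: block n l j \in F (s - q)].
have [q qs|w [sw uw Yw]] := @greedy_representatives _ Y s.+1.
  have iq : s - q < s.+1 by rewrite ltnS leq_subr.
  by have := H (Ordinal iq); rewrite -ltnNge /= -hitsE subKn.
have t0 : 0 < t by case: (t) w sw {uw Yw} => [[|[]]|].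
pose x0 := Ordinal t0.
have [i is_|i [j [is_ js ij]]] := cd (fun i => r @: block n l (nth x0 w (s - i))).
  by have := Yw x0 (s - i); rewrite ltnS leq_subr inE subKn // => /(_ isT).
rewrite imset_disjoint; last exact: perm_inj.
rewrite block_disjoint // nth_uniq ?sw ?ltnS ?leq_subr //.
by apply: contraNneq ij => E; apply/eqP; rewrite -(subKn is_) E subKn.
Qed.
End CrossDependent.

(** * Averaging over placements, and the resulting inequality for the traces *)

Section Averaging.
Local Open Scope ring_scope.

Section Average.
Variables (R : realFieldType) (n l t s : nat).
Hypotheses (l0 : (0 < l)%N) (t1 : (1 < t)%N) (tl : (t * l <= n)%N).
Variable F : nat -> {set {set 'I_n}}.
Hypotheses (Fl : forall i A, A \in F i -> #|A| = l) (cd : cross_dependent s F)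
  (nest : forall i j, (i <= j)%N -> (j <= s)%N -> F j \subset F i).
Local Notation D := ('C(n, l)%:R : R).
Local Notation mu := (t%:R * (#|F s|%:R / D)).

(** A quadratic in the number e of hits of [F s] that majorizes the bound of [cross_dependent_hits]
    is averaged over all placements. The sign of [c] matters because the second moment is bounded
    only from above. *)
Lemma cross_dependent_average (a b c : R) : 0 <= c ->
  (forall e v : R, 0 <= e -> e <= v -> v <= s%:R ->
     (s%:R - v) * t%:R + v ^+ 2 <= a + b * e + c * e ^+ 2) ->
  t%:R * ((\sum_(0 <= i < s) #|F i|)%:R / D) <= a + b * mu + c * (mu ^+ 2 + 2 * mu).
Proof.
move=> c0 maj.
have ln : (l <= n)%N by apply: leq_trans tl; apply: leq_pmull; apply: ltnW.
have P0 : 0 < #|{perm 'I_n}|%:R :> R by rewrite ltr0n; apply/card_gt0P; exists 1%g.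
rewrite -(ler_pM2l P0).
have -> : #|{perm 'I_n}|%:R * (t%:R * ((\sum_(0 <= i < s) #|F i|)%:R / D)) =
    \sum_(r : {perm 'I_n}) (\sum_(0 <= i < s) hits l t (F i) r)%N%:R :> R.
  under [RHS]eq_bigr do rewrite natr_sum.
  rewrite exchange_big /= (eq_bigr (fun i => #|{perm 'I_n}|%:R * (t%:R * (#|F i|%:R / D)))) => [|i _].
    by rewrite natr_sum big_distrl /= !big_distrr.
  by rewrite sum_hits //; apply: Fl.
apply: (@le_trans _ _ (\sum_(r : {perm 'I_n}) (a + b * (hits l t (F s) r)%:R + c * (hits l t (F s) r)%:R ^+ 2))).
  apply: ler_sum => r _; have [v [ev vs le]] := cross_dependent_hits l0 tl r cd nest.
  apply: le_trans (maj _ v%:R _ _ _); rewrite ?ler0n ?ler_nat //.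
  by rewrite -natrB // -natrX -natrM -natrD ler_nat.
rewrite !big_split /= sumr_const -!big_distrr /= sum_hits //; last exact: Fl.
have := sum_hits_sqr l0 tl R t1 (@Fl s); move: (\sum_(r : _) _) => X HX.
rewrite -[a *+ _]mulr_natl; have := ler_wpM2l c0 HX; lra.
Qed.

Lemma cross_dependent_mean : mu <= s%:R.
Proof.
have ln : (l <= n)%N by apply: leq_trans tl; apply: leq_pmull; apply: ltnW.
have P0 : 0 < #|{perm 'I_n}|%:R :> R by rewrite ltr0n; apply/card_gt0P; exists 1%g.
rewrite -(ler_pM2l P0) -sum_hits //; last exact: Fl.
rewrite mulr_natl -sumr_const; apply: ler_sum => r _.
have [v [ev vs _]] := cross_dependent_hits l0 tl r cd nest.
by rewrite ler_nat (leq_trans ev).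
Qed.
End Average.

(* [x] is the normalized sum of the first s families, [al] the density of the last one and
   [h] the normalized size of the family of sets missing the first s + 1 points. When
   mu = t al is small, the parabola S t - t e + 21/20 e^2 bounds the number of hits;
   otherwise its extremal value at mu plus an error term for the deviation of e from mu does. *)
Lemma trace_inequality (R : realFieldType) (S t x al h : R) :
  400 * 400 <= S -> 5 / 3 * S - 2 <= t -> t <= 5 / 3 * S -> 0 <= al -> 0 <= h ->
  t * al <= S -> h <= S * al -> h <= 193 / 500 * S ->
  (forall a b c : R, 0 <= c ->
    (forall e v : R, 0 <= e -> e <= v -> v <= S -> (S - v) * t + v ^+ 2 <= a + b * e + c * e ^+ 2) ->
    t * x <= a + b * (t * al) + c * ((t * al) ^+ 2 + 2 * (t * al))) ->
  x + al + h <= S.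
Proof.
move=> S0 tlo thi al0 h0 muS hal hS avg.
have t0 : 0 < t by lra.
rewrite -(ler_pM2l t0) !mulrDr; set mu := t * al in muS avg *.
have mu0 : 0 <= mu by rewrite mulr_ge0 // ltW.
have [small|large] := lerP mu (5 / 8 * S).
  have thS : t * h <= S * mu by rewrite /mu mulrCA ler_wpM2l // ltW.
  have c0 : 0 <= 21 / 20 :> R by lra.
  have bnd := avg (S * t) (- t) (21 / 20) c0.
  have : t * x <= S * t + - t * mu + 21 / 20 * (mu ^+ 2 + 2 * mu).
    apply: bnd => e v e0 ev vS.
    have S2 : 0 <= S * (S - 400 * 400) by rewrite mulr_ge0 //; lra.
    have tS : t ^+ 2 <= 21 / 5 * S * (t - S).
      have : 0 <= (t - (5 / 3 * S - 2)) * (5 / 3 * S - t) by rewrite mulr_ge0 // subr_ge0.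
      have : 0 <= S * (t - (5 / 3 * S - 2)) by rewrite mulr_ge0 ?subr_ge0 //; lra.
      lra.
    (* The case v = S, a quadratic in e whose discriminant is nonpositive by [tS]; for t = 5S/3 that
       reads 25/9 <= 14/5, hence the coefficient 21/20. *)
    have edge : S ^+ 2 - S * t + t * e - 21 / 20 * e ^+ 2 <= 0.
      by have := sqr_ge0 (t - 21 / 10 * e); lra.
    have inner : 0 <= (v - e) * (S - v) by rewrite mulr_ge0 // subr_ge0.
    (* The left side is convex in v, so its maximum is at v = S or v = e; the sign of e + S - t
       decides which. *)
    have [h1|h1] := lerP 0 (e + S - t).
      have : 0 <= (e + S - t) * (S - v) by rewrite mulr_ge0 // subr_ge0.
      lra.
    have : 0 <= (t - e - S) * (v - e) by rewrite mulr_ge0 //; lra.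
    have := sqr_ge0 e; lra.
  (* This uses 1 + 21/20 * 5/8 < 5/3. *)
  have : mu * (- t + 21 / 20 * mu + 31 / 10 + S) <= 0.
    by rewrite mulr_ge0_le0 //; lra.
  nra.
have d0 : 0 < 1 / 250 * S by lra.
(* [W] is the larger of the values at v = S and v = mu. For v < mu the excess is at most t (mu - e),
   which AM-GM with parameter [d] turns into a quadratic in e. *)
pose W := Num.max (S ^+ 2) ((S - mu) * t + mu ^+ 2); pose d := 1 / 250 * S.
have W1 : S ^+ 2 <= W by rewrite le_max lexx.
have W2 : (S - mu) * t + mu ^+ 2 <= W by rewrite le_max lexx orbT.
have dn : d != 0 by rewrite gt_eqF.
have := avg (W + t / 2 * d + t / 2 * (mu ^+ 2 / d)) (- (t * mu / d)) (t / 2 / d).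
have -> : W + t / 2 * d + t / 2 * (mu ^+ 2 / d) + - (t * mu / d) * mu + t / 2 / d * (mu ^+ 2 + 2 * mu)
  = W + t / 2 * d + t * mu / d by field.
have c0 : 0 <= t / 2 / d by rewrite !divr_ge0 // ltW.
move=> /(_ c0) bnd.
have {}bnd : t * x <= W + t / 2 * d + t * mu / d.
  apply: bnd => e v e0 ev vS.
  have -> : W + t / 2 * d + t / 2 * (mu ^+ 2 / d) + - (t * mu / d) * e + t / 2 / d * e ^+ 2
    = W + t / 2 * (d + (mu - e) ^+ 2 / d) by field.
  have amgm : 2 * (mu - e) <= d + (mu - e) ^+ 2 / d.
    have : 0 <= (mu - e - d) ^+ 2 / d by rewrite divr_ge0 ?sqr_ge0 // ltW.
    rewrite (_ : _ / d = (mu - e) ^+ 2 / d - 2 * (mu - e) + d); last by field.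
    lra.
  have amgm0 : 0 <= d + (mu - e) ^+ 2 / d by rewrite addr_ge0 ?divr_ge0 ?sqr_ge0 // ltW.
  have [muv|vmu] := lerP mu v.
    have : (S - v) * t + v ^+ 2 <= W.
      have [h1|h1] := lerP 0 (v + mu - t); first by nra.
      by nra.
    by have := mulr_ge0 (ltW t0) amgm0; lra.
  have h1 : 0 <= (mu - v) * (mu + v) by rewrite mulr_ge0 //; lra.
  have h2 : 0 <= t * (v - e) by rewrite mulr_ge0 ?subr_ge0 // ltW.
  have := ler_wpM2l (ltW t0) amgm; lra.
have tmd : t * mu / d <= 250 * t.
  by rewrite ler_pdivrMr // /d; nra.
have th : t * h <= t * (193 / 500 * S) by rewrite ler_wpM2l // ltW.
(* Here 153/250 = 1 - 193/500 - 1/500: [h] takes 193/500, and the deviation costs t d / 2 = t S /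
   500 and at most 250 t. *)
have : W + mu <= t * (153 / 250 * S - 250).
  suff : W <= t * (153 / 250 * S - 250) - mu by lra.
  have lo0 : 0 <= t - (5 / 3 * S - 2) by rewrite subr_ge0.
  have large0 : 0 <= mu - 5 / 8 * S by rewrite subr_ge0 ltW.
  have h1 : 0 <= (t - (5 / 3 * S - 2)) * (153 / 250 * S - 250) by rewrite mulr_ge0 //; clear -S0; lra.
  have h2 : 0 <= (mu - 5 / 8 * S) * (S - mu) by rewrite mulr_ge0 // subr_ge0.
  have h3 : 0 <= (t - 13 / 8 * S) * (mu - 5 / 8 * S) by rewrite mulr_ge0 //; clear -S0 tlo; lra.
  have h4 : 0 <= S * (t - (5 / 3 * S - 2)) by rewrite mulr_ge0 //; clear -S0; lra.
  have h5 : 0 <= S * (S - 400 * 400) by rewrite mulr_ge0 ?subr_ge0 //; clear -S0; lra.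
  clear -h1 h2 h3 h4 h5 tlo thi muS S0.
  by rewrite ge_max; apply/andP; split; lra.
have td : t / 2 * d = t * S / 500 by rewrite /d; field.
lra.
Qed.
End Averaging.

(** * The density of the missing part *)

(** Factor by factor, 1 - s / (n - j) >= 1 - s / c, because n - j >= c for j < i. *)
Lemma ffact_scaled n c s i : s <= c -> i + c <= n.+1 ->
  n ^_ i * (c - s) ^ i <= (n - s) ^_ i * c ^ i.
Proof.
move=> sc; elim: i => [|i IH] ic; first by rewrite !ffactn0 !expn0.
rewrite !ffactnSr !expnSr mulnACA [leqRHS]mulnACA leq_mul ?IH //; first by rewrite ltnW.
nia.
Qed.

Lemma sum_crossing_class_ffact n s l r : r <= n -> l <= n ->
  (\sum_(i < l.+2) #|[set B in crossing_class n s l i | below n r \subset B]|) * n ^_ r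
  <= 'C(n, l) * l ^_ r.
Proof.
move=> rn ln.
have Pl B i : B \in crossing_class n s l i -> #|B| = l by case/setIdP; rewrite inE => /eqP.
have [rl|lr] := leqP r l; last first.
  rewrite (ffact_small lr) muln0 big1 // => i _; apply/eqP; rewrite cards_eq0 -subset0.
  apply/subsetP=> B /setIdP[/Pl cB /subset_leq_card].
  by rewrite card_belowE // cB leqNgt lr.
rewrite big_ord_recr /= [X in _ + X](_ : _ = 0) ?addn0; last first.
  apply/eqP; rewrite cards_eq0 -subset0; apply/subsetP=> B /setIdP[BP _].
  have /setIdP[_ /last_crossingP[ci _]] := BP; have := subset_leq_card (subsetIl B (below n (l.+1 * s.+1 - 1))).
  by rewrite ci (Pl _ _ BP) addn0 ltnn.
apply: leq_trans (leq_mul (sum_crossing_class_le s rl ln) (leqnn _)) _.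
by rewrite -!bin_ffact !mulnA mul_bin_bin // [X in X * _]mulnC.
Qed.

Lemma ffact_le_exp m r : m ^_ r <= m ^ r.
Proof. by elim: r => // r IH; rewrite ffactnSr expnSr leq_mul ?leq_subr. Qed.

(** [crossing_class_moment] in the form needed for [class_term], with the falling factorial of the
    segment length relaxed to a power. *)
Lemma crossing_class_ffact n s l i r : 0 < i -> l * s.+1 <= n ->
  #|crossing_class n s l i| * i ^_ r <=
  (i * s.+1) ^ r * #|[set B in crossing_class n s l i | below n r \subset B]|.
Proof.
move=> i0 ln; have [il|li] := leqP i l; last first.
  suff -> : crossing_class n s l i = set0 by rewrite cards0.
  apply/eqP; rewrite -subset0; apply/subsetP=> B /setIdP[cB /last_crossingP[ci _]].
  have := subset_leq_card (subsetIl B (below n (i * s.+1 - 1))).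
  by move: cB; rewrite ci inE addn0 => /eqP ->; rewrite leqNgt li.
have hn : i * s.+1 - 1 <= n.
  by apply: leq_trans (leq_subr _ _) (leq_trans _ ln); rewrite leq_mul2r il orbT.
have := @crossing_class_moment n s l i r i0 hn; rewrite -(leq_pmul2r (fact_gt0 r)) -mulnA bin_ffact.
move/leq_trans; apply; rewrite mulnAC bin_ffact leq_mul2r; apply/orP; right.
apply: leq_trans (ffact_le_exp _ _) _.
by have [->|r0] := posnP r; rewrite ?expn0 // leq_exp2r // leq_subr.
Qed.

Section Bonferroni.
Local Open Scope ring_scope.

Lemma natr_ffact2 (R : comNzRingType) m : (m ^_ 2)%:R = m%:R * (m%:R - 1) :> R.
Proof.
case: m => [|m]; first by rewrite mul0r.
by rewrite ffactnSr ffactn1 natrM natrB.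
Qed.

Lemma natr_ffact3 (R : comNzRingType) m : (m ^_ 3)%:R = m%:R * (m%:R - 1) * (m%:R - 2) :> R.
Proof.
case: m => [|[|m]]; first by rewrite !mul0r.
  by rewrite subrr mulr0 mul0r.
by rewrite ffactnSr natrM natr_ffact2 natrB.
Qed.

(** Multiplying the left side by 1 - y gives the next one plus the nonnegative remainder l (l - 1)
    (l - 2) y^4 / 6. *)
Lemma expB1_Bonferroni (R : realFieldType) (y : R) l : 0 <= y <= 1 ->
  1 - l%:R * y + l%:R * (l%:R - 1) / 2 * y ^+ 2 - l%:R * (l%:R - 1) * (l%:R - 2) / 6 * y ^+ 3
  <= (1 - y) ^+ l.
Proof.
move=> /andP[y0 y1]; elim: l => [|l IH]; first by rewrite expr0; lra.
rewrite [leRHS]exprS -natr1; set L : R := l%:R in IH *.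
have C3 : 0 <= L * (L - 1) * (L - 2).
  rewrite /L; case: (l) => [|[|[|m]]]; rewrite ?mul0r ?subrr ?mulr0 ?mul0r //.
  by rewrite !mulr_ge0 ?ler0n // subr_ge0 ?ler1n // ler_nat.
have y4 : 0 <= L * (L - 1) * (L - 2) * y ^+ 4 by rewrite mulr_ge0 ?exprn_ge0.
have y1' : 0 <= 1 - y by rewrite subr_ge0.
move: (ler_wpM2l y1' IH); move: ((1 - y) ^+ l) => w ; lra.
Qed.

(* The i-th class contributes a factor i/(i+1) = 1/2 + (i-1)/(2(i+1)); the second part is
   controlled by the second and third moments of the class. *)
Lemma class_term (R : realFieldType) (S M Hi G P q2 q3 : R) (i : nat) : (0 < i)%N ->
  0 <= S -> 0 <= P -> 0 <= q2 -> G <= P ->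
  (i%:R + 1) * Hi <= i%:R * S * G ->
  P * (i%:R * (i%:R - 1)) <= (i%:R * M) ^+ 2 * q2 ->
  P * (i%:R * (i%:R - 1) * (i%:R - 2)) <= (i%:R * M) ^+ 3 * q3 ->
  2 * Hi <= S * (G + 2 / 3 * M ^+ 2 * q2 + 1 / 3 * M ^+ 3 * q3).
Proof.
move=> i0 S0 P0 q20 GP; set I : R := i%:R => hH h2 h3.
have I1 : 1 <= I by rewrite ler1n.
have Ip : 0 < I by lra.
have I12 : 0 <= (I - 1) * (I - 2).
  rewrite /I; case: (i) i0 => [//|[|m]] _; first by rewrite subrr mul0r.
  by rewrite mulr_ge0 // subr_ge0 ?ler1n // ler_nat.
have k2 : P * (I - 1) <= I * (M ^+ 2 * q2).
  by rewrite -(ler_pM2l Ip); lra.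
have k3 : P * ((I - 1) * (I - 2)) <= I ^+ 2 * (M ^+ 3 * q3).
  by rewrite -(ler_pM2l Ip); lra.
set a := M ^+ 2 * q2 in k2 *; set b := M ^+ 3 * q3 in k3 *.
(* The weights 2/3 and 1/3 are exact at I = 1 and I = 2: with the lower bounds [k2] and [k3] for a
   and b, the excess times I^2 is P (I - 1) (I - 2) / 3. *)
have key : P * (I - 1) <= (I + 1) * (2 / 3 * a + 1 / 3 * b).
  have I2p : 0 < I ^+ 2 by rewrite exprn_gt0.
  rewrite -(ler_pM2l I2p).
  apply: (@le_trans _ _ ((I + 1) * (2 / 3 * (I * (P * (I - 1))) + 1 / 3 * (P * ((I - 1) * (I - 2)))))); last first.
    have I1p : 0 <= I + 1 by lra.
    have e2 := ler_wpM2l (ltW Ip) k2.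
    have : 2 / 3 * (I * (P * (I - 1))) + 1 / 3 * (P * ((I - 1) * (I - 2))) <=
      I ^+ 2 * (2 / 3 * a + 1 / 3 * b) by lra.
    by move/(ler_wpM2l I1p); lra.
  have : 0 <= P * ((I - 1) * (I - 2)) by rewrite mulr_ge0.
  lra.
have I1p : 0 < I + 1 by lra.
rewrite -(ler_pM2l I1p).
apply: (@le_trans _ _ (2 * (I * S * G))); first by lra.
have : 2 * (I * G) <= (I + 1) * (G + 2 / 3 * a + 1 / 3 * b).
  have : 0 <= (I - 1) * (P - G) by rewrite mulr_ge0 // subr_ge0.
  lra.
move=> /(ler_wpM2l S0); rewrite -[2 / 3 * M ^+ 2 * q2]mulrA -/a -[1 / 3 * M ^+ 3 * q3]mulrA -/b; lra.
Qed.
End Bonferroni.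

Section DensityNumerics.
Local Open Scope ring_scope.

Lemma bin_sub_ge (R : realFieldType) (n s l : nat) (y : R) : (s + l <= n.+1)%N -> (l <= n)%N -> 0 <= y <= 1 ->
  s%:R <= y * (n.+1 - l)%N%:R -> 'C(n, l)%:R * (1 - y) ^+ l <= 'C(n - s, l)%:R.
Proof.
move=> sln ln /andP[y0 y1] hy; set c := (n.+1 - l)%N in hy.
have sc : (s <= c)%N by rewrite /c; lia.
have c0 : 0 < c%:R :> R by rewrite ltr0n /c; lia.
have lc : (l + c <= n.+1)%N by rewrite /c; lia.
have := ffact_scaled sc lc; rewrite -!bin_ffact -(ler_nat R) !natrM !natrX natrB // => main.
have f0 : 0 < l`!%:R :> R by rewrite ltr0n fact_gt0.
rewrite -(ler_pM2r f0) -(ler_pM2r (exprn_gt0 l c0)); apply: le_trans main.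
rewrite [_ * _ * l`!%:R]mulrAC -[leLHS]mulrA ler_wpM2l ?mulr_ge0 ?ler0n //.
rewrite -exprMn lerXn2r // ?nnegrE ?mulr_ge0 ?subr_ge0 ?ler_nat // ?ler0n //.
by rewrite mulrBl mul1r lerD2l lerN2.
Qed.

(** Put z = L y, which is close to 3/5. The bound on [al] and the moment bounds make the bracket at
    most z + z^2 / 6 + z^3 / 2 < 193/250, the source of 193/500. *)
Lemma shadow_numerics (R : realFieldType) (S N al h Q2 Q3 y : R) (l : nat) (L := l%:R : R) :
  2000 <= S -> (0 < l)%N -> 5 / 3 * S * L - 1 <= N -> 0 <= Q2 -> 0 <= Q3 ->
  y * ((5 / 3 * S - 3) * L) = S + 1 ->
  al <= L * y - L * (L - 1) / 2 * y ^+ 2 + L * (L - 1) * (L - 2) / 6 * y ^+ 3 ->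
  Q2 * (N * (N - 1)) <= L * (L - 1) ->
  Q3 * (N * (N - 1) * (N - 2)) <= L * (L - 1) * (L - 2) ->
  2 * h <= S * (al + 2 / 3 * (S + 1) ^+ 2 * Q2 + 1 / 3 * (S + 1) ^+ 3 * Q3) ->
  h <= 193 / 500 * S.
Proof.
move=> S0 l0 hN Q20 Q30 hy hal hQ2 hQ3 hh.
have L1 : 1 <= L by rewrite ler1n.
have S0' : 0 <= S by clear -S0; lra.
have L0 : 0 <= L by rewrite ler0n.
have L32 : 0 <= 3 * L - 2 by clear -L1; lra.
set w := (5 / 3 * S - 3) * L in hy.
have w0 : 0 < w by rewrite mulr_gt0 //; lra.
have wN : w <= N - 2 by rewrite /w; lra.
have y0 : 0 < y by rewrite -(pmulr_lgt0 _ w0) hy; lra.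
have k2 : (S + 1) ^+ 2 * Q2 <= L * (L - 1) * y ^+ 2.
  have : Q2 * (w * w) <= L * (L - 1).
    by apply: le_trans hQ2; rewrite ler_wpM2l // ler_pM //; lra.
  by move/(ler_wpM2l (sqr_ge0 y)); rewrite -hy; lra.
have k3 : (S + 1) ^+ 3 * Q3 <= L * (L - 1) * (L - 2) * y ^+ 3.
  have : Q3 * (w * w * w) <= L * (L - 1) * (L - 2).
    apply: le_trans hQ3; rewrite ler_wpM2l // ler_pM //; try lra.
      by rewrite mulr_ge0 //; lra.
    by rewrite ler_pM //; lra.
  have y3 : 0 <= y ^+ 3 by rewrite exprn_ge0 // ltW.
  by move/(ler_wpM2l y3); rewrite -hy; lra.
pose z := L * y.
have z0 : 0 <= z by rewrite mulr_ge0 // ltW.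
have zle : z <= 601 / 1000.
  have S3 : 0 < 5 / 3 * S - 3 by lra.
  rewrite -(ler_pM2r S3) (_ : z * _ = S + 1); last by rewrite -hy /z /w; ring.
  lra.
have m2 : L * (L - 1) * y ^+ 2 <= z ^+ 2.
  have : 0 <= L * y ^+ 2 by rewrite mulr_ge0 ?sqr_ge0.
  rewrite /z; lra.
have m3 : L * (L - 1) * (L - 2) * y ^+ 3 <= z ^+ 3.
  have : 0 <= L * y ^+ 3 * (3 * L - 2) by rewrite !mulr_ge0 ?exprn_ge0 // ltW.
  rewrite /z; lra.
have z2 : z ^+ 2 <= 601 / 1000 * (601 / 1000) by rewrite expr2 ler_pM.
have z3 : z ^+ 3 <= 601 / 1000 * (601 / 1000) * (601 / 1000).
  by rewrite exprSr ler_pM // exprn_ge0.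
have : al + 2 / 3 * (S + 1) ^+ 2 * Q2 + 1 / 3 * (S + 1) ^+ 3 * Q3 <= 193 / 250.
  rewrite /z in zle z2 z3 m2 m3; clear -hal k2 k3 m2 m3 z2 z3 zle; lra.
move/(ler_wpM2l S0'); clear -hh; lra.
Qed.

Lemma size_numerics (R : realFieldType) (S L N : R) :
  2000 <= S -> 1 <= L -> 5 / 3 * S * L - 1 <= N ->
  [/\ 0 < (5 / 3 * S - 3) * L, L * (S + 1) <= N, 3 <= N, S + 1 <= (5 / 3 * S - 3) * L &
    S + L <= N + 1 /\ S * ((5 / 3 * S - 3) * L) <= (S + 1) * (N + 1 - L)].
Proof.
move=> S0 L1 hN; have SL : 0 <= (S - 2000) * (L - 1) by rewrite mulr_ge0 //; lra.
have L0 : 0 <= (S + 1) * (N - (5 / 3 * S * L - 1)) by rewrite mulr_ge0 //; lra.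
by split; try split; lra.
Qed.
End DensityNumerics.

Section Shadow.
Variables (n s l : nat) (G H : {set {set 'I_n}}).
Hypotheses (Gl : forall B, B \in G -> #|B| = l) (Hl : forall A, A \in H -> #|A| = l.+1)
  (HG : forall A y, A \in H -> y \in A -> A :\ y \in G)
  (HH : forall A, A \in H -> exists2 i, 0 < i & i + 1 <= #|A :&: below n (i * s.+1 - 1)|).
Local Notation Hc i := [set A in H | last_crossing s 1 i A].
Local Notation Gc i := [set B in G | last_crossing s 0 i B].

(** Frankl's inequality: the factor i s / (i + 1) of each class is relaxed to s. *)
Lemma card_le_mul_shadow : #|H| <= s * #|G|.
Proof.
apply: leq_trans (card_le_sum_last_crossing Hl HH) _.
apply: leq_trans (leq_mul (leqnn s) (sum_last_crossing_le s 0 l.+2 G)).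
rewrite big_distrr /= big_mkcond; apply: leq_sum => i _; case: ifP => // i0.
rewrite -(leq_pmul2l i0); apply: leq_trans (leq_mul (leqnSn i) (leqnn _)) _.
by rewrite mulnA; apply: last_crossing_shadow.
Qed.

Local Open Scope ring_scope.

Lemma shadow_density (R : realFieldType) :
  (0 < l)%N -> 2000 <= s%:R :> R -> 5 / 3 * s%:R * l%:R - 1 <= n%:R :> R ->
  (#|G| <= 'C(n, l) - 'C(n - s, l))%N -> #|H|%:R / 'C(n, l)%:R <= 193 / 500 * s%:R :> R.
Proof.
move=> l0 s0 hn hG; pose S : R := s%:R; pose N : R := n%:R; pose L : R := l%:R.
have [S0 L1 hN] : [/\ 2000 <= S, 1 <= L & 5 / 3 * S * L - 1 <= N] by rewrite ler1n.
have [S3L lMn' n3' y1' [sln' Sy']] := size_numerics S0 L1 hN.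
have lMn : (l * s.+1 <= n)%N by rewrite -(ler_nat R) natrM -natr1.
have ln : (l <= n)%N by apply: leq_trans lMn; apply: leq_pmulr.
have n3 : (3 <= n)%N by rewrite -(ler_nat R).
have sln : (s + l <= n.+1)%N by rewrite -(ler_nat R) natrD -natr1.
(* The denominator is at most N - 2, so y bounds (S + 1) / (N - j) for j <= 2; by [Sy'] it also
   suits [bin_sub_ge]. *)
pose y := (S + 1) / ((5 / 3 * S - 3) * L).
have hy : y * ((5 / 3 * S - 3) * L) = S + 1 by rewrite /y divfK // gt_eqF.
have y0 : 0 <= y by rewrite divr_ge0 ?(ltW S3L) // addr_ge0 ?ler0n.
have y1 : y <= 1 by rewrite ler_pdivrMr // mul1r.
have D0 : 0 < 'C(n, l)%:R :> R by rewrite ltr0n bin_gt0.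
set D : R := 'C(n, l)%:R in D0 *.
pose p i : R := #|crossing_class n s l i|%:R.
pose q r i : R := #|[set B in crossing_class n s l i | below n r \subset B]|%:R.
have GP i : (#|Gc i| <= #|crossing_class n s l i|)%N.
  by apply: subset_leq_card; apply/subsetP=> B /setIdP[/Gl cB cl]; rewrite !inE cB eqxx.
have term i : (0 < i)%N -> 2 * #|Hc i|%:R <=
    S * (#|Gc i|%:R + 2 / 3 * (S + 1) ^+ 2 * q 2%N i + 1 / 3 * (S + 1) ^+ 3 * q 3%N i).
  move=> i0; apply: (@class_term _ _ _ _ _ (p i) _ _ i i0); rewrite ?ler0n ?ler_nat //.
  - by rewrite natr1 -!natrM ler_nat; apply: last_crossing_shadow.
  - by rewrite -natr_ffact2 natr1 -natrM -natrX -!natrM ler_nat; apply: crossing_class_ffact.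
  - by rewrite -natr_ffact3 natr1 -natrM -natrX -!natrM ler_nat; apply: crossing_class_ffact.
pose Q r : R := \sum_(i < l.+2) q r i.
have sumq r : (r <= n)%N -> Q r * (n ^_ r)%:R <= D * (l ^_ r)%:R.
  by move=> rn; rewrite /Q -natr_sum -!natrM ler_nat; apply: sum_crossing_class_ffact.
have total : 2 * #|H|%:R <= S * (#|G|%:R + 2 / 3 * (S + 1) ^+ 2 * Q 2%N + 1 / 3 * (S + 1) ^+ 3 * Q 3%N).
  have Sge0 : 0 <= S by rewrite ler0n.
  have term0 i : 0 <= S * (#|Gc i|%:R + 2 / 3 * (S + 1) ^+ 2 * q 2%N i + 1 / 3 * (S + 1) ^+ 3 * q 3%N i).
    by rewrite mulr_ge0 // !addr_ge0 // !mulr_ge0 ?exprn_ge0 ?addr_ge0 ?invr_ge0 ?ler0n.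
  apply: (@le_trans _ _ (\sum_(i < l.+2) S * (#|Gc i|%:R + 2 / 3 * (S + 1) ^+ 2 * q 2%N i +
      1 / 3 * (S + 1) ^+ 3 * q 3%N i))).
    have := card_le_sum_last_crossing Hl HH; rewrite -(ler_nat R) natr_sum => /(ler_wpM2l (ler0n R 2)).
    move=> /le_trans; apply; rewrite big_distrr /= big_mkcond /=; apply: ler_sum => i _.
    by case: ifP => [/term|_] //; apply: term0.
  rewrite -big_distrr ler_wpM2l //= !big_split /= -!big_distrr /= !lerD2r.
  by rewrite -natr_sum ler_nat sum_last_crossing_le.
have Qn r : 0 <= Q r / D by rewrite divr_ge0 ?sumr_ge0 ?(ltW D0) // => i _; rewrite ler0n.
apply: (@shadow_numerics _ S N (#|G|%:R / D) _ (Q 2%N / D) (Q 3%N / D) y l) => //.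
- have := bin_sub_ge sln ln (_ : 0 <= y <= 1) _; rewrite y0 y1 natrB; last exact: ltnW.
  rewrite -natr1 => /(_ isT) bs.
  have {}bs : D * (1 - y) ^+ l <= 'C(n - s, l)%:R.
    by apply: bs; rewrite /y mulrAC ler_pdivlMr.
  have := ler_wpM2l (ltW D0) (expB1_Bonferroni l (_ : 0 <= y <= 1)); rewrite y0 y1 => /(_ isT) bf.
  have Dle : ('C(n - s, l) <= 'C(n, l))%N by apply: leq_bin2l; apply: leq_subr.
  move: hG; rewrite -(ler_nat R) natrB // -/D => hG.
  rewrite ler_pdivrMr //; move: bs bf hG; rewrite -/L; move: ((1 - y) ^+ l) => w; lra.
- rewrite mulrAC ler_pdivrMr // mulrC [leRHS]mulrC [X in X <= _]mulrC -!natr_ffact2; exact: sumq (ltnW n3).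
- by rewrite mulrAC ler_pdivrMr // [leRHS]mulrC -!natr_ffact3; apply: sumq.
rewrite -(ler_pM2r D0); apply: le_trans (_ : 2 * #|H|%:R <= _); first by rewrite -mulrA divfK ?gt_eqF.
by apply: le_trans total _; rewrite le_eqVlt; apply/orP; left; apply/eqP; field; rewrite gt_eqF.
Qed.
End Shadow.

(** * Traces on the first points and the induction *)

Section Trace.
Variables (m N : nat).
Implicit Types (A : {set 'I_m}) (B : {set 'I_N}) (F : {set {set 'I_(m + N)}}).

Definition join A B : {set 'I_(m + N)} := (lshift N @: A) :|: (@rshift m N @: B).
Definition trace F A : {set {set 'I_N}} := [set B | join A B \in F].

Lemma lshift_join A B i : (lshift N i \in join A B) = (i \in A).
Proof.
rewrite inE mem_imset; last exact: lshift_inj.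
by case: imsetP => [[j _ /eqP]|_]; rewrite ?eq_lrshift ?orbF.
Qed.

Lemma rshift_join A B j : (rshift m j \in join A B) = (j \in B).
Proof.
rewrite inE [in X in _ || X]mem_imset; last exact: rshift_inj.
by case: imsetP => [[i _ /eqP]|_]; rewrite ?eq_rlshift.
Qed.

Lemma joinP (C C' : {set 'I_(m + N)}) : (forall i, (lshift N i \in C) = (lshift N i \in C')) ->
  (forall j, (rshift m j \in C) = (rshift m j \in C')) -> C = C'.
Proof. by move=> hl hr; apply/setP=> x; case: (split_ordP x) => i ->. Qed.

Definition unjoin (C : {set 'I_(m + N)}) : {set 'I_m} * {set 'I_N} :=
  ([set i | lshift N i \in C], [set j | rshift m j \in C]).

Lemma unjoinK : cancel unjoin (fun p => join p.1 p.2).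
Proof. by move=> C; apply: joinP => i; rewrite ?lshift_join ?rshift_join inE. Qed.

Lemma joinK : cancel (fun p => join p.1 p.2) unjoin.
Proof.
move=> [A B]; congr (_, _); apply/setP=> i; rewrite inE /=; [exact: lshift_join | exact: rshift_join].
Qed.

Lemma card_join A B : #|join A B| = #|A| + #|B|.
Proof.
rewrite cardsU !card_imset; try exact: rshift_inj; try exact: lshift_inj.
rewrite (_ : _ :&: _ = set0) ?cards0 ?subn0 //; apply/setP=> x; rewrite !inE.
by apply/negP=> /andP[/imsetP[i _ ->] /imsetP[j _ /eqP]]; rewrite eq_lrshift.
Qed.

Lemma join_disjoint A A' B B' : [disjoint A & A'] -> [disjoint B & B'] ->
  [disjoint join A B & join A' B'].
Proof.
move=> dA dB; rewrite -setI_eq0; apply/eqP; apply: joinP => i; rewrite in_setI in_set0.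
  by rewrite !lshift_join; apply/negP=> /andP[iA]; rewrite (disjointFr dA iA).
by rewrite !rshift_join; apply/negP=> /andP[iB]; rewrite (disjointFr dB iB).
Qed.

Lemma card_trace F : #|F| = \sum_A #|trace F A|.
Proof.
rewrite -sum1_card (reindex (fun p => join p.1 p.2)) /=; last first.
  by exists unjoin => C _; [exact: joinK | exact: unjoinK].
rewrite -(pair_big_dep predT (fun A B => join A B \in F) (fun _ _ => 1)) /=.
by apply: eq_bigr => A _; rewrite -sum1dep_card.
Qed.

Lemma sum_card_le1 (f : {set 'I_m} -> nat) :
  \sum_(A : {set 'I_m} | #|A| <= 1) f A = f set0 + \sum_i f [set i].
Proof.
rewrite (bigD1 set0) ?cards0 //=; congr (_ + _).
rewrite -(big_imset f (h := fun i : 'I_m => [set i]) (A := predT)); last by move=> i j _ _ /set1_inj.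
apply: eq_bigl => A; rewrite -cards_eq0; apply/idP/imsetP => [|[i _ ->]]; last by rewrite cards1.
case/andP=> c1 c0; have /cards1P[i ->] : #|A| == 1 by rewrite eqn_leq c1 lt0n.
by exists i.
Qed.

(** Traces on two or more points are bounded by those of the full uniform family. The additive form
    avoids truncated subtraction. *)
Lemma card_uniform_trace l F : F \subset ksubsets (m + N) l.+1 ->
  #|F| + ('C(N, l.+1) + m * 'C(N, l)) <=
  'C(m + N, l.+1) + (#|trace F set0| + \sum_i #|trace F [set i]|).
Proof.
move=> /subsetP Fk; set K := ksubsets _ _ in Fk.
have KA A j : #|A| + j = l.+1 -> #|trace K A| = 'C(N, j).
  move=> Aj; rewrite -[N in RHS]card_ord -card_draws; apply: eq_card => B.
  by rewrite !inE card_join -Aj eqn_add2l.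
have E0 : 'C(N, l.+1) + m * 'C(N, l) = \sum_(A : {set 'I_m} | #|A| <= 1) #|trace K A|.
  rewrite sum_card_le1 (KA _ l.+1) ?cards0 //; congr (_ + _).
  rewrite (eq_bigr (fun=> 'C(N, l))) ?sum_nat_const ?card_ord // => i _.
  by apply: KA; rewrite cards1.
have EK : 'C(m + N, l.+1) = #|K| by rewrite /K /ksubsets card_draws card_ord.
rewrite E0 -(sum_card_le1 (fun A => #|trace F A|)) EK !card_trace.
rewrite (bigID (fun A : {set 'I_m} => #|A| <= 1)) [\sum_A #|trace K A|](bigID (fun A : {set 'I_m} => #|A| <= 1)) /=.
rewrite addnAC [leqRHS]addnAC [X in X + _ <= _]addnC leq_add2l.
apply: leq_sum => A _; apply: subset_leq_card; apply/subsetP=> B; rewrite !inE => /Fk.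
by rewrite inE.
Qed.
End Trace.

(** By nesting, s + 1 disjoint members of [F s] could be distributed over all the families. This
    makes the induction hypothesis applicable to [F s]. *)
Lemma cross_dependent_no_matching n s (F : nat -> {set {set 'I_n}}) : cross_dependent s F ->
  (forall i, i <= s -> F s \subset F i) -> no_matching s (F s).
Proof.
move=> cd nest M MF tM; rewrite leqNgt; apply/negP => sM.
pose w i := nth set0 (enum M) i.
have wM i : i <= s -> w i \in M.
  by move=> is_; rewrite -mem_enum mem_nth // -cardE (leq_ltn_trans is_).
have [i is_|i [j [is_ js ij]]] := cd w.
  by apply: (subsetP (nest i is_)); apply: (subsetP MF); apply: wM.
move/trivIsetP: tM => /(_ _ _ (wM i is_) (wM j js)) dis /negP; apply; apply: dis.
by rewrite nth_uniq ?enum_uniq // -cardE (leq_ltn_trans _ sM).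
Qed.

Section ShiftedTraces.
Variables (s N l : nat) (F : {set {set 'I_(s.+1 + N)}}).
Hypotheses (Fk : F \subset ksubsets (s.+1 + N) l.+1) (nuF : no_matching s F) (sF : shifted F).

Let Fi (i : nat) := trace F [set inord i : 'I_s.+1].
Let H := trace F set0.

Lemma trace_card A B : B \in trace F A -> #|A| + #|B| = l.+1.
Proof. by rewrite inE => /(subsetP Fk); rewrite inE card_join => /eqP. Qed.

Lemma trace1_card i B : B \in Fi i -> #|B| = l.
Proof. by move/trace_card; rewrite cards1 add1n => -[]. Qed.

Lemma trace0_card A : A \in H -> #|A| = l.+1.
Proof. by move/trace_card; rewrite cards0. Qed.

Lemma trace1_nested i j : i <= j -> j <= s -> Fi j \subset Fi i.
Proof.
move=> ij js; have is_ := leq_trans ij js.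
have [->//|nij] := eqVneq i j.
have lij : (inord i : 'I_s.+1) < (inord j : 'I_s.+1) by rewrite !inordK ?ltnS // ltn_neqAle nij.
have nij' : (inord i : 'I_s.+1) != inord j by rewrite neq_ltn lij.
apply/subsetP=> B; rewrite !inE => BF.
have := sF (x := lshift N (inord i)) (y := lshift N (inord j)) lij BF.
rewrite !lshift_join !inE eqxx nij' => /(_ isT isT); congr (_ \in F).
rewrite tperm_imset_swap ?lshift_join ?inE //; apply: joinP => u.
  rewrite in_setU1 in_setD1 !lshift_join !in_set1 !(inj_eq (@lshift_inj _ _)).
  by case: (u == inord j); rewrite ?andbF ?orbF.
by rewrite in_setU1 in_setD1 !rshift_join !eq_rlshift.
Qed.

(** Shiftedness allows y to be replaced by the last of the first s + 1 points. *)
Lemma trace0_shadow A y : A \in H -> y \in A -> A :\ y \in Fi s.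
Proof.
rewrite !inE => AF yA.
have lt : (lshift N (inord s : 'I_s.+1)) < rshift s.+1 y by rewrite /= inordK // ltn_addr.
have := sF (x := lshift N (inord s)) (y := rshift s.+1 y) lt AF.
rewrite lshift_join rshift_join inE yA => /(_ isT isT); congr (_ \in F).
rewrite tperm_imset_swap ?lshift_join ?rshift_join ?inE //; apply: joinP => u.
  by rewrite !in_setU1 in_setD1 !lshift_join !inE eq_lrshift (inj_eq (@lshift_inj _ _)) orbF.
by rewrite !in_setU1 in_setD1 !rshift_join !inE eq_rlshift (inj_eq (@rshift_inj _ _)).
Qed.

Lemma trace1_cross_dependent : cross_dependent s Fi.
Proof.
move=> A AF.
have [/existsP[i /existsP[j /andP[ij dij]]]|] :=
  boolP [exists i : 'I_s.+1, [exists j : 'I_s.+1, (i != j) && ~~ [disjoint A i & A j]]].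
  by exists i, j; split=> //; rewrite -ltnS.
rewrite negb_exists => /forallP dA; exfalso.
suff : #|'I_s.+1| <= s by rewrite card_ord ltnn.
apply: (disjoint_images_no_matching (C := fun i : 'I_s.+1 => join [set i] (A i)) nuF) => [i|i|i j ij].
- by have := AF i; rewrite -ltnS ltn_ord inE inord_val => /(_ isT).
- by apply/set0Pn; exists (lshift N i); rewrite lshift_join inE.
apply: join_disjoint; first by rewrite disjoints1 inE.
by have := dA i; rewrite negb_exists => /forallP/(_ j); rewrite ij /= negbK.
Qed.

(** Dropping s + 1 points lowers the crossing index by one. Index 1 cannot occur, since its segment
    lies within the dropped points. *)
Lemma trace0_crossing A : A \in H ->
  exists2 i, 0 < i & i + 1 <= #|A :&: below N (i * s.+1 - 1)|.
Proof.
rewrite inE => AF; have [i i0 ci] := shifted_crossing (ltn0Sn l) sF Fk nuF AF.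
have E j : #|join set0 A :&: below (s.+1 + N) (j.+1 * s.+1 - 1)| =
           #|A :&: below N (j.+1 * s.+1 - 1 - s.+1)|.
  rewrite -(card_imset _ (@rshift_inj s.+1 N)); apply: eq_card => x.
  apply/setIP/imsetP => [[]|[u /setIP[uA]]].
    rewrite in_setU imset0 in_set0 /= => /imsetP[u uA ->]; rewrite !inE /= => h; exists u => //.
    by rewrite !inE uA /=; move: h; clear; lia.
  by rewrite !inE => h ->; rewrite imset0 in_set0 imset_f //=; split=> //; move: h; clear; lia.
case: i i0 ci => // -[|i] _; rewrite E.
  rewrite mul1n subnAC subnn sub0n.
  by rewrite (_ : below N 0 = set0) ?setI0 ?cards0 //; apply/setP=> x; rewrite !inE.
by move=> ci; exists i.+1 => //; rewrite addn1; apply: leq_trans ci _; apply/subset_leq_card/setIS/belowS; lia.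
Qed.
End ShiftedTraces.

(** * Assembly of the bound, the induction on k, and the extremal family *)

Lemma block_count_numerics (R : realFieldType) (s l N t : nat) :
  400 * 400 <= s -> 5 * s * l <= 3 * N + 3 -> 5 * s <= 3 * t + 5 -> 3 * t <= 5 * s ->
  [/\ 400 * 400 <= s%:R :> R, 2000 <= s%:R :> R, 5 / 3 * s%:R - 2 <= t%:R :> R, t%:R <= 5 / 3 * s%:R :> R &
    5 / 3 * s%:R * l%:R - 1 <= N%:R :> R]%R.
Proof.
rewrite -!(ler_nat R) !natrD !natrM => h1 h2 h3 h4.
by split; lra.
Qed.

Lemma normalized_sum_le (R : realFieldType) (a b c s D : nat) : 0 < D ->
  (a%:R / D%:R + b%:R / D%:R + c%:R / D%:R <= s%:R :> R)%R -> a + b + c <= s * D.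
Proof.
by move=> D0; rewrite -!mulrDl ler_pdivrMr ?ltr0n // -natrM -!natrD ler_nat.
Qed.

Section NestedSum.
Variables (R : realFieldType) (s N l : nat) (F : nat -> {set {set 'I_N}}) (H : {set {set 'I_N}}).
Hypotheses (l0 : 0 < l) (s0 : 400 * 400 <= s) (hN : 5 * s * l <= 3 * N + 3)
  (Fl : forall i B, B \in F i -> #|B| = l) (Hl : forall A, A \in H -> #|A| = l.+1)
  (cd : cross_dependent s F) (nest : forall i j, i <= j -> j <= s -> F j \subset F i)
  (HF : forall A y, A \in H -> y \in A -> A :\ y \in F s)
  (HH : forall A, A \in H -> exists2 i, 0 < i & i + 1 <= #|A :&: below N (i * s.+1 - 1)|)
  (star : #|F s| <= 'C(N, l) - 'C(N - s, l)).

Lemma nested_sum_le : \sum_(0 <= i < s) #|F i| + #|F s| + #|H| <= s * 'C(N, l).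
Proof.
(* The subtracted 1 makes the blocks fit: 3 t l <= 5 s l - 3 l <= 3 N. *)
pose t := (5 * s) %/ 3 - 1.
have s3 : 3 <= s by apply: leq_trans s0.
have [t1 ht1 ht2 ht3] : [/\ 1 < t, 5 * s <= 3 * t + 5, 3 * t <= 5 * s & 3 * t + 3 <= 5 * s].
  by rewrite /t; clear -s3; split; lia.
have tl : t * l <= N by clear -ht3 hN l0; nia.
have ln : l <= N by apply: leq_trans tl; apply: leq_pmull; apply: ltnW.
have [S0 S2 tlo thi hNR] := block_count_numerics R s0 hN ht1 ht2.
have key x al h := @trace_inequality _ _ _ x al h S0 tlo thi.
clear S0 s0.
have dens := shadow_density (Fl (i := s)) Hl HF HH l0 S2 hNR star.
clear S2 hNR tlo thi.
have D0 : 0 < 'C(N, l) by rewrite bin_gt0.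
have D0' : (0 < 'C(N, l)%:R :> R)%R by rewrite ltr0n.
apply: (normalized_sum_le (R := R) D0); apply: key.
- by rewrite divr_ge0 ?ler0n.
- by rewrite divr_ge0 ?ler0n.
- exact: (cross_dependent_mean R l0 t1 tl Fl cd nest).
- rewrite mulrA ler_pM2r ?invr_gt0 // -natrM ler_nat; exact: (card_le_mul_shadow Hl HF HH).
- exact: dens.
by move=> a b c c0 maj; apply: (cross_dependent_average l0 t1 tl Fl cd nest c0 maj).
Qed.
End NestedSum.

Lemma erdos_matching_upper_bound s k n (F : {set {set 'I_n}}) : 400 * 400 <= s -> 0 < k -> 5 * s * k <= 3 * n + 2 * s ->
  F \subset ksubsets n k -> no_matching s F -> #|F| <= 'C(n, k) - 'C(n - s, k).
Proof.
move=> s0; case: k => // k _; elim: k n F => [|l IH] n F hn Fk nu.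
  have sn : s <= n by clear -hn; lia.
  (* A family of singletons is itself a matching. *)
  rewrite !bin1 subKn //; apply: nu => //; apply/trivIsetP=> A B.
  move=> /(subsetP Fk) + /(subsetP Fk); rewrite !inE => /cards1P[x ->] /cards1P[y ->] xy.
  by rewrite disjoints1 inE; apply: contraNneq xy => ->.
have [F' [Fk' nu' <- sF]] := exists_shifted Fk nu.
have sn : s.+1 <= n by have := leq_trans _ s0; clear -hn s0; nia.
have [N nE] : exists N, n = s.+1 + N by exists (n - s.+1); rewrite subnKC.
move: F' Fk' nu' sF; rewrite nE => F' Fk' nu' sF {F Fk nu sn}.
pose Fi i := trace F' [set inord i : 'I_s.+1].
have cdF := trace1_cross_dependent nu' : cross_dependent s Fi.
have nest := trace1_nested sF : forall i j, i <= j -> j <= s -> Fi j \subset Fi i.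
have Fl i B : B \in Fi i -> #|B| = l.+1 by apply: trace1_card.
(* Removing s + 1 points costs 3 s + 3, which with the 2 s of [hn] is the 5 s of one step in k, up
   to the 3. *)
have hN : 5 * s * l.+1 <= 3 * N + 3 by clear -hn nE; nia.
have star : #|Fi s| <= 'C(N, l.+1) - 'C(N - s, l.+1).
  apply: IH; first by clear -hN s0; nia.
    by apply/subsetP=> B /Fl cB; rewrite inE cB.
  by apply: (cross_dependent_no_matching cdF) => i is_; apply: nest.
have := nested_sum_le rat (ltn0Sn l) s0 hN Fl (@trace0_card _ _ _ _ Fk') cdF nest
  (fun A y => trace0_shadow sF (A := A) (y := y)) (trace0_crossing Fk' nu' sF) star.
have := card_uniform_trace Fk'.
have -> : \sum_i #|trace F' [set i]| = \sum_(0 <= i < s) #|Fi i| + #|Fi s|.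
  rewrite -big_nat_recr //= big_mkord; apply: eq_bigr => i _.
  by rewrite /Fi inord_val.
(* Pascal's rule splits C(n - s, k) as C(N, k) + C(N, k - 1); the bound s C(N, k - 1) leaves exactly
   one of the s + 1 copies in [card_uniform_trace]. *)
rewrite (_ : s.+1 + N - s = N.+1); last by rewrite addSn -addnS addKn.
rewrite binS mulSn.
move: #|F'| #|trace F' set0| (\sum_(0 <= i < s) _) #|Fi s| 'C(N, l.+2) 'C(N, l.+1) 'C(s.+1 + N, l.+2).
by move=> a b c d e f g; clear; lia.
Qed.

(** The k-sets meeting the first s points: members of a matching meet them in distinct points. *)
Lemma star_family n k s : 0 < k -> s <= n ->
  exists F : {set {set 'I_n}}, [/\ F \subset ksubsets n k, no_matching s F & #|F| = 'C(n, k) - 'C(n - s, k)].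
Proof.
move=> k0 sn; pose F := [set A in ksubsets n k | A :&: below n s != set0]; exists F; split.
- by apply/subsetP=> A /setIdP[].
- move=> M /subsetP MF tM; rewrite -[leqRHS](card_belowE sn).
  have M0 A : A \in M -> exists x, x \in A :&: below n s.
    by move=> /MF /setIdP[_ /set0Pn].
  pose f A := [pick x in A :&: below n s].
  have fP A : A \in M -> exists2 x, f A = Some x & x \in A :&: below n s.
    rewrite /f => /M0[x xA]; case: pickP => [y yA|/(_ x)]; last by rewrite xA.
    by exists y.
  rewrite -(card_in_imset (f := f)); last first.
    move=> A B AM BM; have [x -> /setIP[xA _]] := fP A AM; have [y -> /setIP[yB _]] := fP B BM.
    move=> [xy]; apply/eqP; apply: contraTT xA => AB.
    by rewrite xy (disjointFl (trivIsetP tM A B AM BM AB) yB).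
  rewrite -[leqRHS](card_imset _ (@Some_inj _)); apply: subset_leq_card; apply/subsetP=> _ /imsetP[A AM ->].
  by have [x -> /setIP[_ xs]] := fP A AM; apply: imset_f.
have -> : F = ksubsets n k :\: [set A : {set 'I_n} | A \subset ~: below n s & #|A| == k].
  apply/setP=> A; rewrite !inE -disjoints_subset -setI_eq0; case: (#|A| == k); by rewrite ?andbT ?andbF.
rewrite cardsD (setIidPr _); last by apply/subsetP=> A; rewrite !inE => /andP[].
have -> : n - s = #|~: below n s| by rewrite [RHS]cardsCs setCK card_ord card_belowE.
by rewrite cards_draws card_draws card_ord.
Qed.

Lemma matching_numberP n (F : {set {set 'I_n}}) s : reflect (no_matching s F) (matching_number F < s.+1).
Proof.
rewrite ltnS; apply: (iffP (bigmax_leqP _ _ _)) => [h M MF tM|h M /andP[MF tM]]; last exact: h.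
by apply: h; rewrite /is_matching MF.
Qed.

Theorem theorem1 :
  exists s0 : nat, forall n k s : nat,
    0 < n -> 0 < k -> 0 < s -> s0 <= s ->
    (5%:R / 3%:R * s%:R * k%:R - 2%:R / 3%:R * s%:R <= n%:R :> rat)%R ->
    max_family_size n k s = 'C(n, k) - 'C(n - s, k).
Proof.
(* The threshold comes from [trace_inequality], where it absorbs the lower-order terms. *)
exists (400 * 400) => n k s n0 k0 s_gt0 s0 hn.
have {}hn : 5 * s * k <= 3 * n + 2 * s.
  rewrite -(ler_nat rat) natrD !natrM; move: hn.
  move: s%:R%R k%:R%R n%:R%R => S K N; lra.
have sn : s <= n by clear -hn k0; nia.
apply/eqP; rewrite eqn_leq; apply/andP; split.
  apply/bigmax_leqP=> F /andP[Fk /matching_numberP nu].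
  exact: erdos_matching_upper_bound.
have [F [Fk nu <-]] := star_family k0 sn.
by rewrite /max_family_size; apply: (leq_bigmax_cond F); rewrite Fk; apply/matching_numberP.
Qed.
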